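(* Let $C$ be an indecomposable non-simple coalgebra over a field $K$. If $C$ is left quasi-coFrobenius, then the Gabriel quiver of $C$ has no sources. Thus, the Gabriel quiver of a non-simple quasi-coFrobenius coalgebra has no sources and no sinks.
   Context: $K$ is a fixed field; all coalgebras and tensor products are over $K$. A coalgebra is simple if it is nonzero and has no subcoalgebras other than $0$ and itself; it is indecomposable if it is not a direct sum of two nonzero subcoalgebras. The dual algebra $C^*$ acts on $C$ by $f\rightharpoonup c=\sum c_1f(c_2)$ (left) and $c\leftharpoonup f=\sum f(c_1)c_2$ (right), where $\Delta_C(c)=\sum c_1\otimes c_2$. $C$ is left quasi-coFrobenius if there is an injective left $C^*$-module map from $C$ to a free left $C^*$-module; right quasi-coFrobenius is defined similarly with right modules; quasi-coFrobenius means both left and right quasi-coFrobenius. Gabriel quiver: let $\{C_n\}$ be the coradical filtration of $C$, that is, $C_0$ is the sum of all simple subcoalgebras of $C$ and $C_n=\{c\in C:\Delta_C(c)\in C_0\otimes C+C\otimes C_{n-1}\}$ for $n\ge 1$. Write $C_0=\bigoplus_{i\in I}D^i$ with $D^i$ simple subcoalgebras, and let $\pi_0:C\to C/C_0$ be the projection. The maps $(\mathrm{Id}\otimes\pi_0)\circ\Delta_C$ and $(\pi_0\otimes \mathrm{Id})\circ\Delta_C$ vanish on $C_0$ and induce $\rho_l:C_1/C_0\to C_0\otimes C_1/C_0$ and $\rho_r:C_1/C_0\to C_1/C_0\otimes C_0$, making $C_1/C_0$ a $C_0$-$C_0$-bicomodule. Put ${}^i(C_1/C_0)^j=\{m\in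 C_1/C_0:\rho_l(m)\in D^i\otimes C_1/C_0,\ \rho_r(m)\in C_1/C_0\otimes D^j\}$, a $D^i$-$D^j$-bicomodule, hence a $(D^j)^*$-$(D^i)^*$-bimodule via $f\cdot m=\sum m_0f(m_1)$, $m\cdot g=\sum g(m_{-1})m_0$, where $\rho_r(m)=\sum m_0\otimes m_1$, $\rho_l(m)=\sum m_{-1}\otimes m_0$. Fix a primitive idempotent $e_i$ in the finite-dimensional simple algebra $(D^i)^*$ for each $i$. The Gabriel quiver $Q(C)$ has vertex set $I$ and $t_{ij}=\dim_K(e_i\cdot{}^j(C_1/C_0)^i\cdot e_j)$ arrows from $i$ to $j$ (independent of the choice of the $e_i$). A source is a vertex at which no arrow ends; a sink is a vertex at which no arrow starts.
   Formalization: The second sentence is proved for an indecomposable coalgebra, as in the first sentence; without ''indecomposable'' it fails, e.g. for the direct sum of two copies of K, whose Gabriel quiver has two isolated vertices. *)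

(* Defs.v *)
From HB Require Import structures.
From mathcomp Require Import all_boot all_algebra.
From mathcomp Require Import generic_quotient ring_quotient sesquilinear.
From mathcomp Require Import boolp classical_sets cardinality.

Set Implicit Arguments.
Unset Strict Implicit.
Unset Printing Implicit Defensive.

Import GRing.Theory.

Local Open Scope ring_scope.
Local Open Scope quotient_scope.
Local Open Scope classical_set_scope.

Notation bilin f := (bilinear_for *:%R *:%R f).

Section Bilin.
Variables (K : fieldType) (U V W : lmodType K) (f : U -> V -> W).
Hypothesis bf : bilin f.

Lemma bilinDl u u' v : f (u + u') v = f u v + f u' v.
Proof. by have := bf.1 v 1 u u'; rewrite /= !scale1r. Qed.

Lemma bilinDr u v v' : f u (v + v') = f u v + f u v'.
Proof. by have := bf.2 u 1 v v'; rewrite /= !scale1r. Qed.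

Lemma bilin0l v : f 0 v = 0.
Proof. by apply: (addrI (f 0 v)); rewrite -bilinDl !addr0. Qed.

Lemma bilin0r u : f u 0 = 0.
Proof. by apply: (addrI (f u 0)); rewrite -bilinDr !addr0. Qed.

Lemma bilinZl a u v : f (a *: u) v = a *: f u v.
Proof. by have := bf.1 v a u 0; rewrite /= !addr0 bilin0l addr0. Qed.

Lemma bilinZr a u v : f u (a *: v) = a *: f u v.
Proof. by have := bf.2 u a v 0; rewrite /= !addr0 bilin0r addr0. Qed.

Lemma bilin_suml I (r : seq I) (F : I -> U) v :
  f (\sum_(i <- r) F i) v = \sum_(i <- r) f (F i) v.
Proof.
elim: r => [|i r IH]; first by rewrite !big_nil bilin0l.
by rewrite !big_cons bilinDl IH.
Qed.

Lemma bilin_sumr I (r : seq I) (F : I -> V) u :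
  f u (\sum_(i <- r) F i) = \sum_(i <- r) f u (F i).
Proof.
elim: r => [|i r IH]; first by rewrite !big_nil bilin0r.
by rewrite !big_cons bilinDr IH.
Qed.

End Bilin.

Section Tensor.
Variables (K : fieldType) (U V : lmodType K).

Definition tens_eval (W : lmodType K) (f : U -> V -> W) (s : seq (U * V)) : W :=
  \sum_(p <- s) f p.1 p.2.

(* A list of pairs stands for the formal sum of the corresponding pure tensors;
   two formal sums are identified when no bilinear map distinguishes them. *)
Definition tens_equiv (s t : seq (U * V)) : bool :=
  `[< forall (W : lmodType K) (f : U -> V -> W), bilin f ->
        tens_eval f s = tens_eval f t >].

Lemma tens_equiv_class : equiv_class_of tens_equiv.
Proof.
split=> [s|s t|t s u].
- by apply/asboolP.
- by apply/idP/idP => /asboolP h; apply/asboolP => W f bf; rewrite h.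
- by move=> /asboolP h /asboolP h'; apply/asboolP => W f bf; rewrite h // h'.
Qed.

Canonical tens_equiv_rel := EquivRelPack tens_equiv_class.
Canonical tens_encModRel := defaultEncModRel tens_equiv.

Definition tensor := {eq_quot tens_equiv}.
HB.instance Definition _ : EqQuotient _ tens_equiv tensor := EqQuotient.on tensor.
HB.instance Definition _ := Choice.on tensor.

Definition tens (u : U) (v : V) : tensor := \pi_tensor [:: (u, v)].

(* The linear map on [tensor] induced by [f]; meaningful for bilinear [f]. *)
Definition tlift (W : lmodType K) (f : U -> V -> W) (x : tensor) : W :=
  tens_eval f (repr x).

Lemma tlift_pi (W : lmodType K) (f : U -> V -> W) s : bilin f ->
  tlift f (\pi_tensor s) = tens_eval f s.
Proof.
move=> bf; rewrite /tlift; have : tens_equiv (repr (\pi_tensor s)) s.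
  by apply/eqmodP; rewrite reprK.
by move/asboolP; apply.
Qed.

Lemma tensorP (x y : tensor) :
  (forall (W : lmodType K) (f : U -> V -> W), bilin f ->
     tlift f x = tlift f y) -> x = y.
Proof.
move=> h; rewrite -[x]reprK -[y]reprK; apply/eqmodP; apply/asboolP => W f bf.
exact: h.
Qed.

Definition tens0 : tensor := \pi_tensor [::].
Definition tens_add (x y : tensor) : tensor := \pi_tensor (repr x ++ repr y).
Definition tens_scale (a : K) (x : tensor) : tensor :=
  \pi_tensor [seq (a *: p.1, p.2) | p <- repr x].
Definition tens_opp := tens_scale (-1).

Lemma tlift_tens0 (W : lmodType K) (f : U -> V -> W) :
  bilin f -> tlift f tens0 = 0.
Proof. by move=> bf; rewrite tlift_pi // /tens_eval big_nil. Qed.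

Lemma tlift_tens_add (W : lmodType K) (f : U -> V -> W) x y :
  bilin f -> tlift f (tens_add x y) = tlift f x + tlift f y.
Proof. by move=> bf; rewrite tlift_pi // /tens_eval big_cat. Qed.

Lemma tlift_tens_scale (W : lmodType K) (f : U -> V -> W) a x :
  bilin f -> tlift f (tens_scale a x) = a *: tlift f x.
Proof.
move=> bf; rewrite tlift_pi // /tens_eval big_map /= scaler_sumr.
by apply: eq_bigr => p _; rewrite bilinZl.
Qed.

Let tE := (tlift_tens0, tlift_tens_add, tlift_tens_scale).

Lemma tens_addA : associative tens_add.
Proof. by move=> x y z; apply: tensorP => W f bf; rewrite !tE // addrA. Qed.

Lemma tens_addC : commutative tens_add.
Proof. by move=> x y; apply: tensorP => W f bf; rewrite !tE // addrC. Qed.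

Lemma tens_add0 : left_id tens0 tens_add.
Proof. by move=> x; apply: tensorP => W f bf; rewrite !tE // add0r. Qed.

Lemma tens_addN : left_inverse tens0 tens_opp tens_add.
Proof.
by move=> x; apply: tensorP => W f bf; rewrite !tE // scaleN1r addNr.
Qed.

HB.instance Definition _ :=
  GRing.isZmodule.Build tensor tens_addA tens_addC tens_add0 tens_addN.

Lemma tens_scaleA a b x : tens_scale a (tens_scale b x) = tens_scale (a * b) x.
Proof. by apply: tensorP => W f bf; rewrite !tE // scalerA. Qed.

Lemma tens_scale1 : left_id 1 tens_scale.
Proof. by move=> x; apply: tensorP => W f bf; rewrite !tE // scale1r. Qed.

Lemma tens_scaleDr : right_distributive tens_scale +%R.
Proof. by move=> a x y; apply: tensorP => W f bf; rewrite !tE // scalerDr. Qed.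

Lemma tens_scaleDl x : {morph tens_scale^~ x : a b / a + b}.
Proof. by move=> a b; apply: tensorP => W f bf; rewrite !tE // scalerDl. Qed.

HB.instance Definition _ := GRing.Zmodule_isLmodule.Build K tensor
  tens_scaleA tens_scale1 tens_scaleDr tens_scaleDl.

Lemma tlift_linear (W : lmodType K) (f : U -> V -> W) :
  bilin f -> linear (tlift f).
Proof. by move=> bf a x y; rewrite tlift_tens_add // tlift_tens_scale. Qed.

Lemma tliftE (W : lmodType K) (f : U -> V -> W) u v :
  bilin f -> tlift f (tens u v) = f u v.
Proof. by move=> bf; rewrite tlift_pi // /tens_eval big_seq1. Qed.

Lemma tens_bilin : bilin tens.
Proof.
split=> [v a u u'|u a v v']; apply: tensorP => W f bf.
  by rewrite tlift_linear // !tliftE // (bf.1 v a u u').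
by rewrite tlift_linear // !tliftE // (bf.2 u a v v').
Qed.

Lemma tlift_sum (W : lmodType K) (f : U -> V -> W) I (r : seq I) F : bilin f ->
  tlift f (\sum_(i <- r) F i) = \sum_(i <- r) tlift f (F i).
Proof.
move=> bf; elim: r => [|i r IH]; first by rewrite !big_nil tlift_tens0.
by rewrite !big_cons tlift_tens_add // IH.
Qed.

Lemma tens_repr (x : tensor) : x = \sum_(p <- repr x) tens p.1 p.2.
Proof.
apply: tensorP => W f bf; rewrite tlift_sum //.
by apply: eq_bigr => p _; rewrite tliftE.
Qed.

Lemma tens_ext (W : lmodType K) (f g : tensor -> W) : linear f -> linear g ->
  (forall u v, f (tens u v) = g (tens u v)) -> f =1 g.
Proof.
have lin0 (h : tensor -> W) : linear h -> h 0 = 0.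
  move=> lh; apply: (addrI (h 0)); have := lh 1 0 0.
  by rewrite !scale1r !addr0 => <-.
move=> lf lg fg x; rewrite (tens_repr x).
elim: (repr x) => [|p s IH]; first by rewrite !big_nil !lin0.
rewrite !big_cons -[tens p.1 p.2]scale1r lf lg IH.
by rewrite fg.
Qed.

End Tensor.

Notation "u ⊗ v" := (tens u v) (at level 40, left associativity) : ring_scope.

Section TensorMap.
Variables (K : fieldType).

Lemma comp_bilin (U V U' V' W : lmodType K) (f : U' -> V' -> W)
    (g : {linear U -> U'}) (h : {linear V -> V'}) :
  bilin f -> bilin (fun u v => f (g u) (h v)).
Proof.
move=> bf; split=> [v a u u'|u a v v'] /=; rewrite linearP.
  exact: (bf.1 (h v)).
exact: (bf.2 (g u)).
Qed.

Definition tmap (U V U' V' : lmodType K) (f : {linear U -> U'})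
    (g : {linear V -> V'}) : tensor U V -> tensor U' V' :=
  tlift (fun u v => f u ⊗ g v).

Lemma tmap_linear (U V U' V' : lmodType K) (f : {linear U -> U'})
  (g : {linear V -> V'}) : linear (tmap f g).
Proof. by apply: tlift_linear; apply: comp_bilin; apply: tens_bilin. Qed.

HB.instance Definition _ (U V U' V' : lmodType K) (f : {linear U -> U'})
    (g : {linear V -> V'}) :=
  GRing.isLinear.Build K (tensor U V) (tensor U' V') _ (tmap f g)
    (tmap_linear f g).

Lemma tmapE (U V U' V' : lmodType K) (f : {linear U -> U'})
  (g : {linear V -> V'}) u v : tmap f g (u ⊗ v) = f u ⊗ g v.
Proof. by rewrite /tmap tliftE //; apply: comp_bilin; apply: tens_bilin. Qed.

Lemma tlift_tmap (U V U' V' W : lmodType K) (f : {linear U -> U'})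
    (g : {linear V -> V'}) (h : U' -> V' -> W) x : bilin h ->
  tlift h (tmap f g x) = tlift (fun u v => h (f u) (g v)) x.
Proof.
move=> bh; apply: (tens_ext (f := fun x => tlift h (tmap f g x))) x.
- by move=> a u v; rewrite linearP tlift_linear.
- by apply: tlift_linear; apply: comp_bilin.
- by move=> u v; rewrite tmapE !tliftE //; apply: comp_bilin.
Qed.

Definition tassoc_aux (U V W : lmodType K) (x : tensor U V) (w : W) :
    tensor U (tensor V W) := tlift (fun u v => u ⊗ (v ⊗ w)) x.

Definition tassoc (U V W : lmodType K) :
    tensor (tensor U V) W -> tensor U (tensor V W) :=
  tlift (@tassoc_aux U V W).

Lemma tassoc_bilin0 (U V W : lmodType K) (w : W) :
  bilin (fun (u : U) (v : V) => u ⊗ (v ⊗ w)).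
Proof.
split=> [v a u u'|u a v v'] /=; first exact: (tens_bilin _ _).1.
by rewrite (bilinDl (tens_bilin _ _)) (bilinZl (tens_bilin _ _))
  (bilinDr (tens_bilin _ _)) (bilinZr (tens_bilin _ _)).
Qed.

Lemma tassoc_bilin (U V W : lmodType K) : bilin (@tassoc_aux U V W).
Proof.
split=> [w|x a w w']; first exact: tlift_linear (tassoc_bilin0 U V w).
rewrite /tassoc_aux /tlift /tens_eval /= scaler_sumr -big_split /=.
apply: eq_bigr => p _.
by rewrite (bilinDr (tens_bilin _ _)) (bilinZr (tens_bilin _ _))
  (bilinDr (tens_bilin _ _)) (bilinZr (tens_bilin _ _)).
Qed.

HB.instance Definition _ (U V W : lmodType K) :=
  GRing.isLinear.Build K _ _ _ (@tassoc U V W)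
    (tlift_linear (tassoc_bilin U V W)).

Lemma tassocE (U V W : lmodType K) (u : U) (v : V) (w : W) :
  tassoc (u ⊗ v ⊗ w) = u ⊗ (v ⊗ w).
Proof.
rewrite /tassoc tliftE; last exact: tassoc_bilin.
by rewrite /tassoc_aux tliftE //; apply: tassoc_bilin0.
Qed.

Lemma tmap_tmap (U V U' V' U'' V'' : lmodType K) (f : {linear U -> U'})
    (g : {linear V -> V'}) (f' : {linear U' -> U''}) (g' : {linear V' -> V''})
    x : tmap f' g' (tmap f g x) = tmap (f' \o f) (g' \o g) x.
Proof. by rewrite {1}/tmap tlift_tmap //; apply: comp_bilin; apply: tens_bilin. Qed.

Lemma eq_tmap (U V U' V' : lmodType K) (f f' : {linear U -> U'})
    (g g' : {linear V -> V'}) : f =1 f' -> g =1 g' -> tmap f g =1 tmap f' g'.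
Proof.
by move=> ff gg x; apply: eq_bigr => p _; rewrite ff gg.
Qed.

Lemma tmap_id (U V : lmodType K) (x : tensor U V) : tmap idfun idfun x = x.
Proof. by rewrite [RHS]tens_repr. Qed.

Lemma tassoc_tmap (U V W U' V' W' : lmodType K) (f : {linear U -> U'})
    (g : {linear V -> V'}) (h : {linear W -> W'}) z :
  tassoc (tmap (tmap f g) h z) = tmap f (tmap g h) (tassoc z).
Proof.
apply: (tens_ext (f := fun z => tassoc (tmap (tmap f g) h z))
  (g := fun z => tmap f (tmap g h) (tassoc z))) z.
- by move=> a u v; rewrite !linearP.
- by move=> a u v; rewrite !linearP.
move=> x w.
apply: (tens_ext (f := fun x => tassoc (tmap (tmap f g) h (x ⊗ w)))
  (g := fun x => tmap f (tmap g h) (tassoc (x ⊗ w)))) x.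
- move=> a u v; rewrite (bilinDl (tens_bilin _ _)) (bilinZl (tens_bilin _ _)).
  by rewrite !linearP.
- move=> a u v; rewrite (bilinDl (tens_bilin _ _)) (bilinZl (tens_bilin _ _)).
  by rewrite !linearP.
by move=> u v; rewrite !(tmapE, tassocE) /= !(tmapE, tassocE).
Qed.

Section TriLinear.
Variables (U V W X : lmodType K) (T : U -> V -> W -> X).
Hypothesis T1 : forall v w, linear (fun u => T u v w).
Hypothesis T2 : forall u w, linear (fun v => T u v w).
Hypothesis T3 : forall u v, linear (T u v).

Let trl x w := tlift (fun u v => T u v w) x.
Let trr u y := tlift (T u) y.

Let trl_bilin0 w : bilin (fun u v => T u v w).
Proof. by split=> [v|u]; [apply: T1|apply: T2]. Qed.

Let trr_bilin0 u : bilin (T u).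
Proof. by split=> [v|w]; [apply: T2|apply: T3]. Qed.

Lemma trl_bilin : bilin trl.
Proof.
split=> [w|x a w w']; first exact: tlift_linear (trl_bilin0 w).
rewrite /trl /tlift /tens_eval /= scaler_sumr -big_split /=.
by apply: eq_bigr => p _; rewrite T3.
Qed.

Lemma trr_bilin : bilin trr.
Proof.
split=> [y a u u'|u]; last exact: tlift_linear (trr_bilin0 u).
rewrite /trr /tlift /tens_eval /= scaler_sumr -big_split /=.
by apply: eq_bigr => p _; rewrite T1.
Qed.

Lemma tlift_assoc z : tlift trl z = tlift trr (tassoc z).
Proof.
have l1 := tlift_linear trl_bilin.
have l2 := tlift_linear trr_bilin.
apply: (tens_ext (f := tlift trl) (g := fun z => tlift trr (tassoc z))) z => //.
  by move=> a u v; rewrite linearP l2.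
move=> x w.
apply: (tens_ext (f := fun x => tlift trl (x ⊗ w))
  (g := fun x => tlift trr (tassoc (x ⊗ w)))) x => /=.
- move=> a u v.
  by rewrite (bilinDl (tens_bilin _ _)) (bilinZl (tens_bilin _ _)) l1.
- move=> a u v.
  by rewrite (bilinDl (tens_bilin _ _)) (bilinZl (tens_bilin _ _)) linearP l2.
move=> u v; rewrite tassocE tliftE; last exact: trl_bilin.
rewrite tliftE; last exact: trr_bilin.
rewrite /trl /trr tliftE; last exact: trl_bilin0.
by rewrite tliftE //; apply: trr_bilin0.
Qed.

End TriLinear.

End TensorMap.
Arguments tassoc {K U V W}.

HB.mixin Record Lmodule_isCoalgebra (K : fieldType) C
    of GRing.Lmodule K C := {
  comul : {linear C -> tensor C C};
  counit : {scalar C};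
  comulA : forall c,
    tassoc (tmap comul idfun (comul c)) = tmap idfun comul (comul c);
  counitl : forall c, tlift (fun a b => counit a *: b) (comul c) = c;
  counitr : forall c, tlift (fun a b => counit b *: a) (comul c) = c
}.

#[short(type="coalgType")]
HB.structure Definition Coalgebra (K : fieldType) :=
  { C of Lmodule_isCoalgebra K C & GRing.Lmodule K C }.

Arguments comul {K s}.
Arguments counit {K s}.

Section SubmodOpp.
Variables (K : fieldType) (V : lmodType K) (S : submodClosed V).

Lemma submodB u v : u \in S -> v \in S -> u - v \in S.
Proof. by move=> uS vS; rewrite rpredD // -scaleN1r rpredZ. Qed.

Definition zmod_of_submod : {pred V} := S.

Lemma zmod_of_submod_closed : zmod_closed zmod_of_submod.
Proof. by split; [apply: (rpred0 S)|exact: submodB]. Qed.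

HB.instance Definition _ :=
  GRing.isZmodClosed.Build V zmod_of_submod zmod_of_submod_closed.

End SubmodOpp.

Section Span.
Variables (K : fieldType) (V : lmodType K).

Definition span_pred (A : set V) : {pred V} := fun v =>
  `[< exists s : seq (K * V),
        (forall p, p \in s -> A p.2) /\ v = \sum_(p <- s) p.1 *: p.2 >].

Lemma span_closed (A : set V) : submod_closed (span_pred A).
Proof.
split=> [|a u v /asboolP[s [sA ->]] /asboolP[t [tA ->]]]; apply/asboolP.
  by exists [::]; split=> //; rewrite big_nil.
exists ([seq (a * p.1, p.2) | p <- s] ++ t); split=> [p|].
  by rewrite mem_cat => /orP[/mapP[q qs ->]|/tA//]; exact: sA qs.
rewrite big_cat big_map scaler_sumr /=; congr (_ + _).
by apply: eq_bigr => p _; rewrite scalerA.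
Qed.

HB.instance Definition _ (A : set V) :=
  GRing.isSubmodClosed.Build K V (span_pred A) (span_closed A).

Definition span (A : set V) : submodClosed V := span_pred A.

Lemma sub_span (A : set V) v : A v -> v \in span A.
Proof.
move=> Av; apply/asboolP; exists [:: (1, v)]; split=> [p|].
  by rewrite inE => /eqP->.
by rewrite big_seq1 scale1r.
Qed.

Lemma span_min (A : set V) (S : submodClosed V) :
  (forall v, A v -> v \in S) -> forall v, v \in span A -> v \in S.
Proof.
move=> AS v /asboolP[s [sA ->]]; rewrite big_seq.
by apply: rpred_sum => p ps; apply: rpredZ; apply: AS; apply: sA.
Qed.

Lemma span_eq (W : lmodType K) (A : set V) (f g : {linear V -> W}) :
  (forall v, A v -> f v = g v) -> forall v, v \in span A -> f v = g v.
Proof.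
move=> fg v /asboolP[s [sA ->]]; rewrite !linear_sum big_seq [RHS]big_seq.
by apply: eq_bigr => p ps; rewrite !linearZ /= fg //; apply: sA.
Qed.

End Span.

(* For subspaces [A], [B] of [U], [V] the tensor product of [A] and [B] is
   identified, as usual over a field, with its image in [tensor U V]. *)
Definition tsub (K : fieldType) (U V : lmodType K)
    (A : submodClosed U) (B : submodClosed V) : submodClosed (tensor U V) :=
  span [set x | exists a b, [/\ a \in A, b \in B & x = a ⊗ b]].

Definition fullsub (K : fieldType) (V : lmodType K) : submodClosed V :=
  span setT.

Definition addsub (K : fieldType) (V : lmodType K) (A B : submodClosed V) :
    submodClosed V := span ([set` A] `|` [set` B]).

Section Preimage.
Variables (K : fieldType) (U V : lmodType K).
Variables (f : {linear U -> V}).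

Definition preimsub_pred (B : submodClosed V) : {pred U} := fun u => f u \in B.

Lemma preimsub_closed B : submod_closed (preimsub_pred B).
Proof.
have E u : (u \in preimsub_pred B) = (f u \in B) by [].
split=> [|a u v]; rewrite !E ?linear0 ?rpred0 // linearP => fu fv.
by rewrite rpredD // rpredZ.
Qed.

HB.instance Definition _ B :=
  GRing.isSubmodClosed.Build K U (preimsub_pred B) (preimsub_closed B).

Definition preimsub (B : submodClosed V) : submodClosed U := preimsub_pred B.

Definition imsub_pred (A : submodClosed U) : {pred V} :=
  fun v => `[< exists2 u, u \in A & v = f u >].

Lemma imsub_closed A : submod_closed (imsub_pred A).
Proof.
split=> [|a _ _ /asboolP[u uA ->] /asboolP[v vA ->]]; apply/asboolP.
  by exists 0; rewrite ?rpred0 ?linear0.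
by exists (a *: u + v); rewrite ?linearP // rpredD // rpredZ.
Qed.

HB.instance Definition _ A :=
  GRing.isSubmodClosed.Build K V (imsub_pred A) (imsub_closed A).

Definition imsub (A : submodClosed U) : submodClosed V := imsub_pred A.

End Preimage.

Section SubType.
Variables (K : fieldType) (V : lmodType K) (S : submodClosed V).

Record subv := SubV { incl : V; _ : incl \in S }.
HB.instance Definition _ := [isSub for incl].
HB.instance Definition _ := [Choice of subv by <:].
HB.instance Definition _ := [SubChoice_isSubLmodule of subv by <:].

Lemma incl_linear : linear incl.
Proof. by move=> a u v; rewrite -[incl]/val linearP. Qed.
HB.instance Definition _ := GRing.isLinear.Build K subv V _ incl incl_linear.

Lemma inclP (x : subv) : incl x \in S.
Proof. exact: valP x. Qed.

Lemma incl_inj : injective incl.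
Proof. exact: val_inj. Qed.

Lemma complement_ex : exists W : set V,
  [/\ forall a u v, W u -> W v -> W (a *: u + v),
      forall w, W w -> w \in S -> w = 0 &
      forall v, exists s w, [/\ s \in S, W w & v = s + w]].
Proof.
pose P (W : set V) := (forall a u v, W u -> W v -> W (a *: u + v)) /\
  (forall w, W w -> w \in S -> w = 0).
have [F FP totF|W [[Wlin WS] maxW]] := @Zorn_bigcup V P.
  split=> [a u v [X FX Xu] [Y FY Yv]|w [X FX Xw]]; last exact: (FP _ FX).2.
  have [XY|YX] := totF _ _ FX FY.
    by exists Y => //; apply: (FP _ FY).1 => //; apply: XY.
  by exists X => //; apply: (FP _ FX).1 => //; apply: YX.
have W0 : W 0.
  apply: contrapT => nW0; apply: (maxW (W `|` [set 0])).
    by split=> [w Ww|/(_ 0)]; [left|move=> h; apply: nW0; apply: h; right].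
  split=> [a u v [Wu|->] [Wv|->]|w [Ww|->]//]; last exact: WS.
  - by left; apply: Wlin.
  - left; rewrite addr0; have -> : a *: u = (a - 1) *: u + u.
      by rewrite scalerBl scale1r subrK.
    exact: Wlin.
  - by left; rewrite scaler0 add0r.
  - by right; rewrite scaler0 addr0.
exists W; split=> // v; apply: contrapT => nv.
pose W' : set V := [set x | exists a w, W w /\ x = w + a *: v].
apply: (maxW W').
  split=> [w Ww|/(_ v) h]; first by exists 0, w; rewrite scale0r addr0.
  have Wv : W v by apply: h; exists 1, 0; rewrite scale1r add0r.
  by apply: nv; exists 0, v; rewrite rpred0 add0r.
split=> [a _ _ [b [w [Ww ->]]] [c [w' [Ww' ->]]]|_ [a [w [Ww ->]]] wS].
  exists (a * b + c), (a *: w + w'); split; first exact: Wlin.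
  by rewrite scalerDr scalerDl scalerA addrACA.
have [a0|a0] := eqVneq a 0.
  by move: wS; rewrite a0 scale0r addr0 => wS; apply: WS.
case: nv; exists (a^-1 *: (w + a *: v)), ((- a^-1) *: w + 0); split.
- exact: rpredZ.
- exact: Wlin.
- by rewrite scalerDr scalerA mulVf // scale1r addr0 scaleNr addrAC subrr add0r.
Qed.

Lemma retract_ex : exists p : {linear V -> subv}, forall x, p (incl x) = x.
Proof.
have [W [Wlin WS Wex]] := complement_ex.
have ex v : exists x : subv, W (v - incl x).
  have [s [w [sS Ww ->]]] := Wex v.
  by exists (SubV sS); rewrite /= addrAC subrr add0r.
pose p v := projT1 (cid (ex v)).
have pP v : W (v - incl (p v)) by rewrite /p; case: cid.
have W0 : W 0.
  have := Wlin (-1) _ _ (pP 0) (pP 0).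
  by rewrite scaleN1r addNr.
have pU v x : W (v - incl x) -> p v = x.
  move=> Wx; apply: incl_inj; apply/eqP; rewrite -subr_eq0; apply/eqP.
  apply: WS; last by rewrite submodB ?inclP.
  have := Wlin (-1) _ _ (pP v) Wx; rewrite scaleN1r opprB.
  by rewrite addrA subrK.
have plin : linear p.
  move=> a u v; apply: pU.
  have -> : a *: u + v - incl (a *: p u + p v) =
            a *: (u - incl (p u)) + (v - incl (p v)).
    by rewrite incl_linear scalerBr opprD addrACA.
  by apply: Wlin; apply: pP.
pose pL := GRing.isLinear.Build K V subv _ p plin.
pose q : {linear V -> subv} := HB.pack p pL.
by exists q => x; apply: pU; rewrite subrr.
Qed.

(* A linear retraction of the inclusion of [S]; it is only used to invert maps
   such as [tmap incl incl] on their image, where the choice is immaterial. *)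
Definition retract : {linear V -> subv} := projT1 (cid retract_ex).

Lemma inclK (x : subv) : retract (incl x) = x.
Proof. by rewrite /retract; case: cid. Qed.

Lemma retractK v : v \in S -> incl (retract v) = v.
Proof. by move=> vS; rewrite -[v]/(incl (SubV vS)) inclK. Qed.

End SubType.

Section QuotientSpace.
Variables (K : fieldType) (V : lmodType K) (S : submodClosed V).

Definition quotv := Quotient.quot (zmod_of_submod S).
HB.instance Definition _ := GRing.Zmodule.on quotv.

Definition qproj (v : V) : quotv := \pi_(Quotient.quot (zmod_of_submod S)) v.
Definition qrepr (x : quotv) : V := repr (x : Quotient.quot (zmod_of_submod S)).

Lemma qreprK x : qproj (qrepr x) = x.
Proof. exact: reprK. Qed.

Lemma qproj_eq u v : (qproj u = qproj v) <-> (u - v \in S).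
Proof.
rewrite -[_ \in S]/(_ \in zmod_of_submod S) Quotient.idealrBE; split=> [/eqP|/eqP]; exact.
Qed.

Lemma qprojD u v : qproj (u + v) = qproj u + qproj v.
Proof. by rewrite /qproj; apply: raddfD. Qed.

Definition qscale (a : K) (x : quotv) : quotv := qproj (a *: qrepr x).

Lemma qprojZ a v : qproj (a *: v) = qscale a (qproj v).
Proof.
apply/qproj_eq; rewrite -scalerBr rpredZ //; apply/qproj_eq.
by rewrite qreprK.
Qed.

Lemma qscaleA a b x : qscale a (qscale b x) = qscale (a * b) x.
Proof. by rewrite -[x]qreprK -!qprojZ scalerA. Qed.

Lemma qscale1 : left_id 1 qscale.
Proof. by move=> x; rewrite -[x]qreprK -qprojZ scale1r. Qed.

Lemma qscaleDr : right_distributive qscale +%R.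
Proof.
move=> a x y; rewrite -[x]qreprK -[y]qreprK.
by rewrite -qprojD -!qprojZ scalerDr qprojD.
Qed.

Lemma qscaleDl x : {morph qscale^~ x : a b / a + b}.
Proof. by move=> a b; rewrite -[x]qreprK -!qprojZ scalerDl qprojD. Qed.

HB.instance Definition _ := GRing.Zmodule_isLmodule.Build K quotv
  qscaleA qscale1 qscaleDr qscaleDl.

Lemma qproj_linear : linear qproj.
Proof. by move=> a u v; rewrite qprojD qprojZ. Qed.

HB.instance Definition _ :=
  GRing.isLinear.Build K V quotv _ qproj qproj_linear.

End QuotientSpace.

(* Both sides are the sum of the T c_1 c_2 c_3 in Sweedler's notation. *)
Lemma sweedler3 (K : fieldType) (C : coalgType K) (X : lmodType K)
    (T : C -> C -> C -> X) :
  (forall v w, linear (fun u => T u v w)) ->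
  (forall u w, linear (fun v => T u v w)) ->
  (forall u v, linear (T u v)) -> forall c,
  tlift (fun a b => tlift (fun a1 a2 => T a1 a2 b) (comul a)) (comul c) =
  tlift (fun a b => tlift (fun b1 b2 => T a b1 b2) (comul b)) (comul c).
Proof.
move=> T1 T2 T3 c.
have := tlift_assoc T1 T2 T3 (tmap comul idfun (comul c)).
rewrite comulA !tlift_tmap //; [exact: trr_bilin | exact: trl_bilin].
Qed.

Section Dual.
Variables (K : fieldType) (C : coalgType K).

Definition dual := {scalar C}.
Identity Coercion dual_to_scalar : dual >-> GRing.Linear.type.

HB.instance Definition _ := gen_eqMixin dual.
HB.instance Definition _ := gen_choiceMixin dual.

Definition mkdual (f : C -> K) (lf : scalar f) : dual :=
  HB.pack_for {scalar C} f (GRing.isLinear.Build K C K _ f lf).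

Lemma dualP (f g : dual) : (f : C -> K) =1 g -> f = g.
Proof.
case: f g => [f [[f1] [f2]]] [g [[g1] [g2]]] /= fg.
have {}fg : f = g by apply: funext.
move: f1 f2; rewrite fg => f1 f2.
by rewrite (Prop_irrelevance f1 g1) (Prop_irrelevance f2 g2).
Qed.

Lemma dual_add_linear (f g : dual) : scalar (fun c => f c + g c).
Proof. by move=> a u v; rewrite !linearP /= mulrDr addrACA. Qed.

Lemma dual_opp_linear (f : dual) : scalar (fun c => - f c).
Proof. by move=> a u v; rewrite linearP /= opprD mulrN. Qed.

Lemma dual_zero_linear : scalar (fun _ : C => 0 : K).
Proof. by move=> a u v; rewrite mulr0 addr0. Qed.

Definition dual_add (f g : dual) : dual := mkdual (dual_add_linear f g).
Definition dual_opp (f : dual) : dual := mkdual (dual_opp_linear f).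
Definition dual_zero : dual := mkdual dual_zero_linear.

Lemma dual_addA : associative dual_add.
Proof. by move=> f g h; apply: dualP => c /=; rewrite addrA. Qed.
Lemma dual_addC : commutative dual_add.
Proof. by move=> f g; apply: dualP => c /=; rewrite addrC. Qed.
Lemma dual_add0 : left_id dual_zero dual_add.
Proof. by move=> f; apply: dualP => c /=; rewrite add0r. Qed.
Lemma dual_addN : left_inverse dual_zero dual_opp dual_add.
Proof. by move=> f; apply: dualP => c /=; rewrite addNr. Qed.

HB.instance Definition _ :=
  GRing.isZmodule.Build dual dual_addA dual_addC dual_add0 dual_addN.

Lemma conv_bilin (f g : dual) : bilin (fun a b : C => f a * g b : K^o).
Proof.
split=> [v a u u'|u a v v'] /=; rewrite linearP /=.
  by rewrite mulrDl -mulrA.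
by rewrite mulrDr mulrCA.
Qed.

Lemma hitl_bilin (f : dual) : bilin (fun a b : C => f b *: a).
Proof.
split=> [v a u u'|u a v v'] /=; last by rewrite linearP /= scalerDl scalerA.
by rewrite scalerDr !scalerA mulrC.
Qed.

Lemma hitr_bilin (f : dual) : bilin (fun a b : C => f a *: b).
Proof.
split=> [v a u u'|u a v v'] /=; first by rewrite linearP /= scalerDl scalerA.
by rewrite scalerDr !scalerA mulrC.
Qed.

Lemma conv_linear (f g : dual) :
  scalar (fun c : C => tlift (fun a b => f a * g b : K^o) (comul c)).
Proof.
by move=> a u v; rewrite linearP /= tlift_linear //; apply: conv_bilin.
Qed.

Definition conv (f g : dual) : dual := mkdual (conv_linear f g).

(* The actions f ⇀ c and c ↼ f. *)
Definition hitl (f : dual) (c : C) : C :=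
  tlift (fun a b => f b *: a) (comul c).
Definition hitr (c : C) (f : dual) : C :=
  tlift (fun a b => f a *: b) (comul c).

Lemma tlift_comp (U V W W' : lmodType K) (f : U -> V -> W) (h : W -> W') x :
  linear h -> h (tlift f x) = tlift (fun u v => h (f u v)) x.
Proof.
move=> lh; pose hL : {linear W -> W'} :=
  HB.pack h (GRing.isLinear.Build K W W' _ h lh).
by rewrite -[h]/(hL : W -> W') /tlift /tens_eval linear_sum.
Qed.

Lemma conv_hitl (f g : dual) c : conv f g c = f (hitl g c).
Proof.
rewrite /= /hitl /tlift /tens_eval linear_sum; apply: eq_bigr => p _.
by rewrite linearZ /= mulrC.
Qed.

Lemma conv_hitr (f g : dual) c : conv f g c = g (hitr c f).
Proof.
rewrite /= /hitr /tlift /tens_eval linear_sum; apply: eq_bigr => p _.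
by rewrite linearZ.
Qed.

Let counitD : dual := counit.

Lemma conv1l : left_id counitD conv.
Proof. by move=> f; apply: dualP => c; rewrite conv_hitr /hitr counitl. Qed.

Lemma conv1r : right_id counitD conv.
Proof. by move=> f; apply: dualP => c; rewrite conv_hitl /hitl counitr. Qed.

Lemma hitl_linear f : linear (hitl f).
Proof. by move=> a u v; rewrite /hitl linearP tlift_linear //; apply: hitl_bilin. Qed.

Lemma hitr_linear f : linear (hitr^~ f).
Proof. by move=> a u v; rewrite /hitr linearP tlift_linear //; apply: hitr_bilin. Qed.

HB.instance Definition _ f := GRing.isLinear.Build K C C _ (hitl f) (hitl_linear f).

Lemma hitlA (f g : dual) c : hitl f (hitl g c) = hitl (conv f g) c.
Proof.
pose T (a b d : C) := (f b * g d) *: a.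
have T1 b d : linear (fun a => T a b d).
  by move=> k a a'; rewrite /T scalerDr !scalerA mulrC.
have T2 a d : linear (fun b => T a b d).
  by move=> k b b'; rewrite /T linearP /= mulrDl scalerDl scalerA mulrA.
have T3 a b : linear (T a b).
  by move=> k d d'; rewrite /T linearP /= mulrDr scalerDl scalerA mulrCA.
transitivity (tlift (fun a b => tlift (T a) (comul b)) (comul c)); last first.
  by apply: eq_bigr => p _; rewrite /T /tlift /tens_eval -scaler_suml.
rewrite -(sweedler3 T1 T2 T3) {2}/hitl (tlift_comp _ _ (hitl_linear f)); apply: eq_bigr => p _.
rewrite linearZ /= /hitl /tlift /tens_eval scaler_sumr.
by apply: eq_bigr => q _; rewrite /T scalerA mulrC.
Qed.

Lemma hitrA (f g : dual) c : hitr (hitr c f) g = hitr c (conv f g).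
Proof.
pose T (a b d : C) := (f a * g b) *: d.
have T1 b d : linear (fun a => T a b d).
  by move=> k a a'; rewrite /T linearP /= mulrDl scalerDl scalerA mulrA.
have T2 a d : linear (fun b => T a b d).
  by move=> k b b'; rewrite /T linearP /= mulrDr scalerDl scalerA mulrCA.
have T3 a b : linear (T a b).
  by move=> k d d'; rewrite /T scalerDr !scalerA mulrC.
transitivity (tlift (fun a b => tlift (fun a1 a2 => T a1 a2 b) (comul a))
    (comul c)); last first.
  by apply: eq_bigr => p _; rewrite /T /tlift /tens_eval -scaler_suml.
rewrite (sweedler3 T1 T2 T3) {2}/hitr (tlift_comp _ _ (hitr_linear g)).
apply: eq_bigr => p _.
rewrite /hitr linearZ /= tlift_tens_scale; last exact: hitr_bilin.
rewrite /tlift /tens_eval scaler_sumr.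
by apply: eq_bigr => q _; rewrite /T scalerA.
Qed.

Lemma convA : associative conv.
Proof.
move=> f g h; apply: dualP => c.
by rewrite conv_hitl [RHS]conv_hitl -hitlA -conv_hitl.
Qed.

Lemma convDl : left_distributive conv dual_add.
Proof.
move=> f g h; apply: dualP => c /=; rewrite /tlift /tens_eval -big_split /=.
by apply: eq_bigr => p _; rewrite mulrDl.
Qed.

Lemma convDr : right_distributive conv dual_add.
Proof.
move=> f g h; apply: dualP => c /=; rewrite /tlift /tens_eval -big_split /=.
by apply: eq_bigr => p _; rewrite mulrDr.
Qed.

(* The dual algebra, with the convolution product; it is the zero ring when
   [C] is zero. *)
HB.instance Definition _ :=
  GRing.Zmodule_isPzRing.Build dual convA conv1l conv1r convDl convDr.

End Dual.

(* The coalgebra [C] as a left, resp. right, module over its dual algebra;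
   right modules are left modules over the converse ring. *)
Section DualModules.
Variables (K : fieldType) (C : coalgType K).

Definition lcoalg : Type := C.
HB.instance Definition _ := GRing.Zmodule.on lcoalg.

Definition rcoalg : Type := C.
HB.instance Definition _ := GRing.Zmodule.on rcoalg.

Definition lcoalg_scale (f : dual C) (c : lcoalg) : lcoalg := hitl f c.
Definition rcoalg_scale (f : (dual C)^c) (c : rcoalg) : rcoalg := hitr c f.

Lemma lcoalg_scaleA f g c :
  lcoalg_scale f (lcoalg_scale g c) = lcoalg_scale (f * g) c.
Proof. exact: hitlA. Qed.

Lemma lcoalg_scale1 : left_id 1 lcoalg_scale.
Proof. by move=> c; rewrite /lcoalg_scale /hitl counitr. Qed.

Lemma lcoalg_scaleDr : right_distributive lcoalg_scale +%R.
Proof. by move=> f c d; rewrite /lcoalg_scale linearD. Qed.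

Lemma lcoalg_scaleDl c : {morph lcoalg_scale^~ c : f g / f + g}.
Proof.
move=> f g; rewrite /lcoalg_scale /hitl /tlift /tens_eval -big_split /=.
by apply: eq_bigr => p _; rewrite scalerDl.
Qed.

HB.instance Definition _ := GRing.Zmodule_isLmodule.Build (dual C) lcoalg
  lcoalg_scaleA lcoalg_scale1 lcoalg_scaleDr lcoalg_scaleDl.

Lemma rcoalg_scaleA f g c :
  rcoalg_scale f (rcoalg_scale g c) = rcoalg_scale (f * g) c.
Proof. exact: hitrA. Qed.

Lemma rcoalg_scale1 : left_id 1 rcoalg_scale.
Proof. by move=> c; rewrite /rcoalg_scale /hitr counitl. Qed.

Lemma rcoalg_scaleDr : right_distributive rcoalg_scale +%R.
Proof.
move=> f c d; have := hitr_linear (f : dual C) 1 c d.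
by rewrite !scale1r.
Qed.

Lemma rcoalg_scaleDl c : {morph rcoalg_scale^~ c : f g / f + g}.
Proof.
move=> f g; rewrite /rcoalg_scale /hitr /tlift /tens_eval -big_split /=.
by apply: eq_bigr => p _; rewrite scalerDl.
Qed.

HB.instance Definition _ := GRing.Zmodule_isLmodule.Build (dual C)^c rcoalg
  rcoalg_scaleA rcoalg_scale1 rcoalg_scaleDr rcoalg_scaleDl.

End DualModules.

Section FreeModule.
Variables (R : pzRingType) (J : Type).

Record freemod := FreeMod {
  free_coef :> J -> R;
  free_supp : finite_set [set j | free_coef j <> 0]
}.

HB.instance Definition _ := gen_eqMixin freemod.
HB.instance Definition _ := gen_choiceMixin freemod.

Lemma freemodP (x y : freemod) : (x : J -> R) =1 y -> x = y.
Proof.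
case: x y => [x xP] [y yP] /= xy; have {}xy : x = y by apply: funext.
by move: xP; rewrite xy => xP; rewrite (Prop_irrelevance xP yP).
Qed.

Lemma free0_supp : finite_set [set j : J | (0 : R) <> 0].
Proof. by apply: (sub_finite_set _ (finite_set0 J)) => j /=. Qed.

Lemma freeD_supp (x y : freemod) : finite_set [set j : J | x j + y j <> 0].
Proof.
apply: (@sub_finite_set _ _ ([set j | x j <> 0] `|` [set j | y j <> 0])).
  move=> j /= xy; apply: contrapT => /not_orP[/contrapT x0 /contrapT y0].
  by apply: xy; rewrite x0 y0 addr0.
by rewrite finite_setU; split; apply: free_supp.
Qed.

Lemma freeN_supp (x : freemod) : finite_set [set j : J | - x j <> 0].
Proof.
apply: sub_finite_set (free_supp x) => j /= x0 xj.
by apply: x0; rewrite xj oppr0.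
Qed.

Lemma freeZ_supp a (x : freemod) : finite_set [set j : J | a * x j <> 0].
Proof.
apply: sub_finite_set (free_supp x) => j /= x0 xj.
by apply: x0; rewrite xj mulr0.
Qed.

Definition free0 := FreeMod free0_supp.
Definition free_add x y := FreeMod (freeD_supp x y).
Definition free_opp x := FreeMod (freeN_supp x).
Definition free_scale a x := FreeMod (freeZ_supp a x).

Lemma free_addA : associative free_add.
Proof. by move=> x y z; apply: freemodP => j /=; rewrite addrA. Qed.
Lemma free_addC : commutative free_add.
Proof. by move=> x y; apply: freemodP => j /=; rewrite addrC. Qed.
Lemma free_add0 : left_id free0 free_add.
Proof. by move=> x; apply: freemodP => j /=; rewrite add0r. Qed.
Lemma free_addN : left_inverse free0 free_opp free_add.
Proof. by move=> x; apply: freemodP => j /=; rewrite addNr. Qed.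

HB.instance Definition _ :=
  GRing.isZmodule.Build freemod free_addA free_addC free_add0 free_addN.

Lemma free_scaleA a b x : free_scale a (free_scale b x) = free_scale (a * b) x.
Proof. by apply: freemodP => j /=; rewrite mulrA. Qed.
Lemma free_scale1 : left_id 1 free_scale.
Proof. by move=> x; apply: freemodP => j /=; rewrite mul1r. Qed.
Lemma free_scaleDr : right_distributive free_scale +%R.
Proof. by move=> a x y; apply: freemodP => j /=; rewrite mulrDr. Qed.
Lemma free_scaleDl x : {morph free_scale^~ x : a b / a + b}.
Proof. by move=> a b; apply: freemodP => j /=; rewrite mulrDl. Qed.

HB.instance Definition _ := GRing.Zmodule_isLmodule.Build R freemod
  free_scaleA free_scale1 free_scaleDr free_scaleDl.

End FreeModule.

Definition left_quasi_coFrobenius (K : fieldType) (C : coalgType K) : Prop :=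
  exists (J : Type) (phi : {linear lcoalg C -> freemod (dual C) J}),
    injective phi.

Definition right_quasi_coFrobenius (K : fieldType) (C : coalgType K) : Prop :=
  exists (J : Type) (phi : {linear rcoalg C -> freemod (dual C)^c J}),
    injective phi.

Definition quasi_coFrobenius (K : fieldType) (C : coalgType K) : Prop :=
  left_quasi_coFrobenius C /\ right_quasi_coFrobenius C.

Section Subcoalgebra.
Variables (K : fieldType) (C : coalgType K).

Record subcoalgebra := SubCoalgebra {
  subcoalg_space :> submodClosed C;
  subcoalg_comul : forall c, c \in subcoalg_space ->
    comul c \in tsub subcoalg_space subcoalg_space
}.

End Subcoalgebra.

Section SubcoalgebraType.
Variables (K : fieldType) (C : coalgType K) (D : subcoalgebra C).

Let D' := subv D.
Let i : {linear D' -> C} := @incl _ _ D.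
Let r : {linear C -> D'} := retract D.

Definition sub_comul (x : D') : tensor D' D' := tmap r r (comul (incl x)).

Lemma sub_comul_linear : linear sub_comul.
Proof. by move=> a x y; rewrite /sub_comul !linearP. Qed.

HB.instance Definition _ :=
  GRing.isLinear.Build K D' (tensor D' D') _ sub_comul sub_comul_linear.

Definition sub_counit (x : D') : K := counit (incl x).

Lemma sub_counit_linear : scalar sub_counit.
Proof. by move=> a x y; rewrite /sub_counit !linearP. Qed.

HB.instance Definition _ :=
  GRing.isLinear.Build K D' K _ sub_counit sub_counit_linear.

Lemma sub_comulE x : tmap i i (sub_comul x) = comul (incl x).
Proof.
have := subcoalg_comul (inclP x).
apply: (span_eq (f := tmap i i \o tmap r r) (g := idfun)).
by move=> _ [a [b [aD bD ->]]] /=; rewrite !tmapE /= !retractK.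
Qed.

Lemma tmap3_inj : injective (tmap i (tmap i i)).
Proof.
apply: (can_inj (g := tmap r (tmap r r))) => x; rewrite tmap_tmap.
rewrite -[RHS]tmap_id; apply: eq_tmap => y /=; first exact: inclK.
rewrite tmap_tmap -[RHS]tmap_id; apply: eq_tmap => z /=; exact: inclK.
Qed.

Lemma sub_comulA x :
  tassoc (tmap sub_comul idfun (sub_comul x)) =
  tmap idfun sub_comul (sub_comul x).
Proof.
apply: tmap3_inj; rewrite -tassoc_tmap !(tmap_tmap _ _ _ _ (sub_comul x)).
transitivity (tassoc (tmap comul idfun (tmap i i (sub_comul x)))).
  congr (tassoc _); rewrite (tmap_tmap _ _ _ _ (sub_comul x)).
  by apply: eq_tmap => y //=; apply: sub_comulE.
rewrite sub_comulE comulA -sub_comulE (tmap_tmap _ _ _ _ (sub_comul x)).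
by apply: eq_tmap => y //=; rewrite -sub_comulE.
Qed.

Lemma sub_counitl x : tlift (fun a b => sub_counit a *: b) (sub_comul x) = x.
Proof.
apply: incl_inj; rewrite (tlift_comp _ _ (@incl_linear _ _ D)).
rewrite -[RHS]counitl -sub_comulE (tlift_tmap i i (sub_comul x)); last exact: (hitr_bilin (counit : dual C)).
by apply: eq_bigr => p _; rewrite linearZ.
Qed.

Lemma sub_counitr x : tlift (fun a b => sub_counit b *: a) (sub_comul x) = x.
Proof.
apply: incl_inj; rewrite (tlift_comp _ _ (@incl_linear _ _ D)).
rewrite -[RHS]counitr -sub_comulE (tlift_tmap i i (sub_comul x)); last exact: (hitl_bilin (counit : dual C)).
by apply: eq_bigr => p _; rewrite linearZ.
Qed.

HB.instance Definition _ := Lmodule_isCoalgebra.Build K (subv D)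
  sub_comulA sub_counitl sub_counitr.

End SubcoalgebraType.

Definition simple_coalgebra (K : fieldType) (C : coalgType K) : Prop :=
  (exists c : C, c != 0) /\
  forall D : subcoalgebra C,
    (forall c, c \in D -> c = 0) \/ (forall c, c \in D).

Definition indecomposable (K : fieldType) (C : coalgType K) : Prop :=
  ~ exists A B : subcoalgebra C,
    [/\ exists2 a, a \in A & a != 0,
        exists2 b, b \in B & b != 0,
        forall c, c \in A -> c \in B -> c = 0 &
        forall c, exists a b, [/\ a \in A, b \in B & c = a + b]].

Section CoradicalFiltration.
Variables (K : fieldType) (C : coalgType K).

Definition coradical : submodClosed C :=
  span [set c | exists D : subcoalgebra C,
                  simple_coalgebra (subv D) /\ c \in D].

Fixpoint corad_filt (n : nat) : submodClosed C :=
  if n is m.+1 then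
    preimsub comul (addsub (tsub coradical (fullsub C))
                           (tsub (fullsub C) (corad_filt m)))
  else coradical.

Definition corad_quot := quotv coradical.
HB.instance Definition _ := GRing.Lmodule.on corad_quot.

(* C_1 / C_0, as a subspace of C / C_0 *)
Definition corad_layer1 : submodClosed corad_quot :=
  imsub (qproj coradical) (corad_filt 1).

Lemma coradical_comull c :
  c \in coradical -> tmap idfun (qproj coradical) (comul c) = 0.
Proof.
apply: (span_eq (f := tmap idfun (qproj coradical) \o comul) (g := \0)).
move=> d [D [sD dD]] /=; have := subcoalg_comul dD.
apply: (span_eq (f := tmap idfun (qproj coradical)) (g := \0)).
move=> _ [a [b [aD bD ->]]] /=; rewrite tmapE /= (_ : qproj coradical b = 0).
  exact: bilin0r (tens_bilin _ _) _.
rewrite -(linear0 (qproj coradical)); apply/qproj_eq; rewrite subr0.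
by apply: sub_span; exists D.
Qed.

Lemma coradical_comulr c :
  c \in coradical -> tmap (qproj coradical) idfun (comul c) = 0.
Proof.
apply: (span_eq (f := tmap (qproj coradical) idfun \o comul) (g := \0)).
move=> d [D [sD dD]] /=; have := subcoalg_comul dD.
apply: (span_eq (f := tmap (qproj coradical) idfun) (g := \0)).
move=> _ [a [b [aD bD ->]]] /=; rewrite tmapE /= (_ : qproj coradical a = 0).
  exact: bilin0l (tens_bilin _ _) _.
rewrite -(linear0 (qproj coradical)); apply/qproj_eq; rewrite subr0.
by apply: sub_span; exists D.
Qed.

(* The maps induced on C / C_0 by (Id ⊗ π_0) ∘ Δ and (π_0 ⊗ Id) ∘ Δ; the
   bicomodule structure of C_1 / C_0 is their restriction. *)
Definition rho_l (m : corad_quot) : tensor C corad_quot :=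
  tmap idfun (qproj coradical) (comul (qrepr m)).
Definition rho_r (m : corad_quot) : tensor corad_quot C :=
  tmap (qproj coradical) idfun (comul (qrepr m)).

Lemma rho_lE c :
  rho_l (qproj coradical c) = tmap idfun (qproj coradical) (comul c).
Proof.
apply/eqP; rewrite -subr_eq0 -!linearB; apply/eqP/coradical_comull.
by apply/qproj_eq; rewrite qreprK.
Qed.

Lemma rho_rE c :
  rho_r (qproj coradical c) = tmap (qproj coradical) idfun (comul c).
Proof.
apply/eqP; rewrite -subr_eq0 -!linearB; apply/eqP/coradical_comulr.
by apply/qproj_eq; rewrite qreprK.
Qed.

(* ^D(C_1 / C_0)^E, a sub-bicomodule of C_1 / C_0 *)
Definition layer1_comp (D E : subcoalgebra C) : set corad_quot :=
  [set m | [/\ m \in corad_layer1, rho_l m \in tsub D corad_layer1 &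
               rho_r m \in tsub corad_layer1 E]].

(* f · m for f in the dual algebra of [E] and rho_r m in (C_1 / C_0) ⊗ E:
   [tmap idfun (retract E)] inverts the inclusion of (C / C_0) ⊗ E. *)
Definition layer1_lact (E : subcoalgebra C) (f : dual (subv E))
    (m : corad_quot) : corad_quot :=
  tlift (fun m0 m1 => f m1 *: m0) (tmap idfun (retract E) (rho_r m)).

(* m · g for g in the dual algebra of [D] and rho_l m in D ⊗ (C_1 / C_0) *)
Definition layer1_ract (D : subcoalgebra C) (m : corad_quot)
    (g : dual (subv D)) : corad_quot :=
  tlift (fun m1 m0 => g m1 *: m0) (tmap (retract D) idfun (rho_l m)).

End CoradicalFiltration.

Section LinearFamilies.
Variables (K : fieldType) (V : lmodType K) (X : Type).

Definition lin_indep (b : X -> V) : Prop :=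
  forall n (x : 'I_n -> X) (a : 'I_n -> K), injective x ->
    \sum_t a t *: b (x t) = 0 -> forall t, a t = 0.

Definition is_basis (b : X -> V) (S : set V) : Prop :=
  lin_indep b /\ forall v, S v <-> v \in span (range b).

Definition is_direct_sum (A : X -> submodClosed V) (S : submodClosed V) :
    Prop :=
  (forall n (x : 'I_n -> X) (v : 'I_n -> V), injective x ->
     (forall t, v t \in A (x t)) -> \sum_t v t = 0 -> forall t, v t = 0) /\
  S =i span (\bigcup_x [set` A x]).

End LinearFamilies.

Definition primitive_idempotent (R : pzRingType) (e : R) : Prop :=
  [/\ e != 0, e * e = e &
      forall f g : R, f * f = f -> g * g = g -> f * g = 0 -> g * f = 0 ->
        e = f + g -> f = 0 \/ g = 0].

Record quiver := Quiver { vertex : Type; arrow : vertex -> vertex -> Type }.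

Definition is_source (Q : quiver) (v : vertex Q) : Prop :=
  forall u, arrow u v -> False.

Definition is_sink (Q : quiver) (v : vertex Q) : Prop :=
  forall u, arrow v u -> False.

(* The quiver is only determined up to isomorphism: [Q] is a Gabriel quiver of
   [C] when its vertices index the simple summands of the coradical and its
   arrows from i to j index a basis of e_i · ^j(C_1 / C_0)^i · e_j. *)
Definition is_Gabriel_quiver (K : fieldType) (C : coalgType K) (Q : quiver) :
    Prop :=
  exists (D : vertex Q -> subcoalgebra C) (e : forall i, dual (subv (D i))),
  [/\ forall i, simple_coalgebra (subv (D i)),
      is_direct_sum (fun i => D i : submodClosed C) (coradical C),
      forall i, primitive_idempotent (e i) &
      forall i j, exists b : arrow i j -> corad_quot C,
        is_basis b [set layer1_ract (layer1_lact (e i) m) (e j) |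
                     m in layer1_comp (D j) (D i)]].

(* Main.v *)
Require Import Defs.
From mathcomp Require Import all_boot all_algebra.
From HB Require Import structures.
From mathcomp Require Import sesquilinear boolp classical_sets.

(** Functionals act on a coalgebra C by f ⇀ c and c ↼ f, and subcoalgebras are
the subspaces stable under both actions.  Let D be the simple subcoalgebra at a
source and C0 the coradical.

No arrow ends at D, hence C has no second socle layer over D: if f ⇀ c lies in
D for every f vanishing on C0, then c is in C0.  Otherwise [socle_over] gives
such an element c outside C0 and a simple subcoalgebra B with f ⇀ c in C0 for
every f vanishing on B.  The class of c is a nonzero element of the component
of C1 / C0 belonging to D and B, and the primitive idempotents cannot
annihilate this component, because a nonzero idempotent generates a simple
algebra as a two-sided ideal ([peirce_corner_nonzero]); so there is an arrow
from B to D.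

Consequently D is an injective right comodule and C is the direct sum of D and
a left submodule X ([no_second_layer_split]).  If g is the counit on D and zero
on X, then c ↼ g is the projection of c to D.  An embedding of C into a free
left module has a coordinate psi, a module map from C to its dual algebra, with
psi(x) nonzero for some x in D.  Then psi(x) ⇀ c is in D for all c: a
functional f vanishing on D satisfies f ⇀ x = 0, hence f * psi(x) = 0.
Moreover psi(x) is nonzero on D, since x = g ⇀ x gives
psi(x)(c) = psi(x)(c ↼ g).  So the two-sided ideal of all h with h ⇀ C inside D
does not vanish on D, and its annihilator is a subcoalgebra that meets D
trivially and contains X ([balanced_split]).  This makes D a direct summand of
the coalgebra C, so that C = D is simple when C is indecomposable.

For sinks the same argument runs with the two actions exchanged; the side is a
boolean parameter throughout.  Finite-dimensional arguments are replaced by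
separation by functionals and by minimality of the number of terms in a
comultiplication. *)

Set Implicit Arguments.
Unset Strict Implicit.
Unset Printing Implicit Defensive.

Import GRing.Theory Defs.

Local Open Scope ring_scope.
Local Open Scope classical_set_scope.

(** * Extension and separation by linear functionals *)

Section LinearExtension.
Variable K : fieldType.

Lemma in_fullsub (V : lmodType K) (v : V) : v \in fullsub V.
Proof. exact: (@sub_span K V setT v I). Qed.

Lemma qproj0 (V : lmodType K) (S : submodClosed V) v :
  (qproj S v = 0) <-> (v \in S).
Proof. by rewrite -(linear0 (qproj S)) qproj_eq subr0. Qed.

(** Every extension of a functional from a subspace goes through this splitting. *)
Lemma linear_left_inverse (U V : lmodType K) (j : {linear U -> V}) :
  injective j -> exists r : {linear V -> U}, cancel j r.
Proof.
move=> inj_j; pose S := imsub j (fullsub U).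
have ex (y : subv S) : exists u, incl y = j u.
  by have /asboolP[u _ ->] := inclP y; exists u.
pose k y := projT1 (cid (ex y)).
have kE y : j (k y) = incl y by rewrite /k; case: cid.
have k_lin : linear k.
  by move=> a x y; apply: inj_j; rewrite linearP !kE linearP.
pose kL : {linear subv S -> U} :=
  HB.pack k (GRing.isLinear.Build K (subv S) U _ k k_lin).
exists (kL \o retract S) => u; apply: inj_j; rewrite /= kE retractK //.
by apply/asboolP; exists u; rewrite ?in_fullsub.
Qed.

Lemma separating_functional (V : lmodType K) (S : submodClosed V) v :
  v \notin S -> exists2 f : {scalar V}, f v != 0 & forall s, s \in S -> f s = 0.
Proof.
move=> vS; pose j (a : K^o) := (a : K) *: qproj S v.
have j_lin : linear j by move=> a x y; rewrite /j scalerDl scalerA.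
pose jL : {linear K^o -> quotv S} :=
  HB.pack j (GRing.isLinear.Build K K^o (quotv S) _ j j_lin).
have qv0 : qproj S v != 0.
  by apply: contra vS => /eqP/qproj0.
have inj_j : injective jL.
  move=> a b /= /eqP; rewrite -subr_eq0 -scalerBl scaler_eq0 (negPf qv0) orbF.
  by rewrite subr_eq0 => /eqP.
have [r rK] := linear_left_inverse inj_j.
exists (r \o qproj S) => [|s sS] /=.
  by have := rK 1; rewrite /= /j scale1r => ->; apply: oner_neq0.
by rewrite (_ : qproj S s = 0) ?linear0 //; apply/qproj0.
Qed.

Lemma nonvanishing_functional (V : lmodType K) (v : V) :
  v != 0 -> exists f : {scalar V}, f v != 0.
Proof.
move=> v0; have [|f fv _] := @separating_functional V (span set0) v.
  apply: contra v0 => /asboolP[s [s0 ->]]; apply/eqP.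
  by case: s s0 => [|p s /(_ p)]; rewrite ?big_nil // mem_head => /(_ isT).
by exists f.
Qed.

(** The functional is built on the quotient by B, into which A embeds because it
meets B trivially. *)
Lemma functional_glue (V : lmodType K) (A B : submodClosed V) (f : {scalar V}) :
  (forall v, v \in A -> v \in B -> v = 0) ->
  exists2 g : {scalar V}, forall a, a \in A -> g a = f a &
                          forall b, b \in B -> g b = 0.
Proof.
move=> AB0; pose j : {linear subv A -> quotv B} := qproj B \o @incl _ _ A.
have inj_j : injective j.
  move=> x y /= /qproj_eq xyB; apply: incl_inj; apply/eqP; rewrite -subr_eq0; apply/eqP.
  by apply: AB0 => //; apply: submodB; apply: inclP.
have [r rK] := linear_left_inverse inj_j.
exists (f \o (@incl _ _ A \o (r \o qproj B))) => [a aA|b bB] /=.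
  by rewrite -{1}(retractK aA) -[qproj _ _]/(j _) rK retractK.
by rewrite (_ : qproj B b = 0) ?linear0 //; apply/qproj0.
Qed.

End LinearExtension.

(** * Elements of a tensor product seen through functionals *)

Section TensorSeparation.
Variable K : fieldType.

Lemma evr_bilin (U V : lmodType K) (g : {scalar V}) :
  bilin (fun (u : U) (v : V) => g v *: u).
Proof.
split=> [v a u u'|u a v v'] /=; last by rewrite linearP /= scalerDl scalerA.
by rewrite scalerDr !scalerA mulrC.
Qed.

Lemma evl_bilin (U V : lmodType K) (f : {scalar U}) :
  bilin (fun (u : U) (v : V) => f u *: v).
Proof.
split=> [v a u u'|u a v v'] /=; first by rewrite linearP /= scalerDl scalerA.
by rewrite scalerDr !scalerA mulrC.
Qed.

Definition lincomb (V : lmodType K) n (w : 'I_n -> V) (k : 'rV[K]_n) : V :=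
  \sum_i k 0 i *: w i.

Lemma lincomb_linear (V : lmodType K) n (w : 'I_n -> V) : linear (lincomb w).
Proof.
move=> a k l; rewrite /lincomb scaler_sumr -big_split; apply: eq_bigr => i _.
by rewrite !mxE scalerDl scalerA.
Qed.

HB.instance Definition _ (V : lmodType K) n (w : 'I_n -> V) :=
  GRing.isLinear.Build K 'rV[K]_n V _ (lincomb w) (lincomb_linear w).

(** Induction on the number of terms: either the first b is a combination of the
others and can be eliminated, or a functional isolates it and shows that its
coefficient is zero. *)
Lemma sum_tens_eq0 (U V : lmodType K) n (a : 'I_n -> U) (b : 'I_n -> V) :
  (forall g : {scalar V}, \sum_i g (b i) *: a i = 0) -> \sum_i a i ⊗ b i = 0.
Proof.
have bT := tens_bilin U V.
elim: n a b => [|n IH] a b ab0; first by rewrite big_ord0.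
rewrite big_ord_recl.
set w := fun i => b (lift ord0 i).
have [/asboolP[k _ bE]|bw] := boolP (b ord0 \in imsub (lincomb w) (fullsub _)).
  rewrite bE /lincomb (bilin_sumr bT) -big_split /=.
  under eq_bigr => i _ do rewrite (bilinZr bT) -(bilinZl bT) -(bilinDl bT).
  apply: IH => g; rewrite -[RHS](ab0 g) big_ord_recl bE linear_sum scaler_suml.
  rewrite -big_split; apply: eq_bigr => i _.
  by rewrite linearZ /= scalerDr !scalerA mulrC.
have [g gb0 gw] := separating_functional bw.
have gb i : g (b (lift ord0 i)) = 0.
  apply: gw; apply/asboolP; exists (delta_mx 0 i); first exact: in_fullsub.
  rewrite /= /lincomb (bigD1 i) //= big1 => [|j ji]; last first.
    by rewrite !mxE eqxx (negPf ji) scale0r.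
  by rewrite !mxE !eqxx scale1r addr0.
have a0 : a ord0 = 0.
  have := ab0 g; rewrite big_ord_recl big1 => [|i _]; last by rewrite gb scale0r.
  by rewrite addr0 => /eqP; rewrite scaler_eq0 (negPf gb0) => /eqP.
rewrite a0 (bilin0l bT) add0r; apply: IH => g'.
by rewrite -[RHS](ab0 g') big_ord_recl a0 scaler0 add0r.
Qed.

Lemma tens_separated (U V : lmodType K) (x y : tensor U V) :
  (forall (f : {scalar U}) (g : {scalar V}),
     f (tlift (fun a b => g b *: a) x) = f (tlift (fun a b => g b *: a) y)) ->
  x = y.
Proof.
move=> fg; apply/eqP; rewrite -subr_eq0; apply/eqP.
have xy0 (g : {scalar V}) : tlift (fun a b => g b *: a) (x - y) = 0.
  pose z := tlift (fun a b => g b *: a) (x - y); rewrite -/z.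
  have [//|/nonvanishing_functional[f]] := eqVneq z 0.
  move=> /negP[]; apply/eqP; rewrite /z; have lg := tlift_linear (evr_bilin U g).
  rewrite -scaleN1r addrC lg linearP /= -fg.
  by rewrite mulN1r addNr.
rewrite (tens_repr (x - y)) big_tnth; apply: sum_tens_eq0 => g.
by rewrite -[RHS](xy0 g) /tlift /tens_eval [RHS]big_tnth.
Qed.

(** A linear projection of U onto A fixes every contraction of x by a functional
on the second factor, so contractions cannot tell x from its image under the
tensor product of projections onto A and B.  This is how subcoalgebras are
recognised from the two actions. *)
Lemma tsub_intro (U V : lmodType K) (A : submodClosed U) (B : submodClosed V)
    (x : tensor U V) :
  (forall g : {scalar V}, tlift (fun a b => g b *: a) x \in A) ->
  (forall f : {scalar U}, tlift (fun a b => f a *: b) x \in B) ->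
  x \in tsub A B.
Proof.
move=> xA xB.
pose pA : {linear U -> U} := @incl _ _ A \o retract A.
pose pB : {linear V -> V} := @incl _ _ B \o retract B.
have -> : x = tmap pA pB x.
  have swap (f : {scalar U}) (g : {scalar V}) :
      f (tlift (fun a b => g b *: a) x) = g (tlift (fun a b => f a *: b) x).
    rewrite /tlift /tens_eval !linear_sum; apply: eq_bigr => p _.
    by rewrite !linearZ /= mulrC.
  apply: tens_separated => f g; rewrite tlift_tmap; last exact: evr_bilin.
  transitivity (f (pA (tlift (fun a b => g (pB b) *: a) x))); last first.
    congr (f _); rewrite /tlift /tens_eval linear_sum.
    by apply: eq_bigr => p _; rewrite linearZ.
  rewrite [pA _](retractK (xA (g \o pB))) !swap /= -[in LHS](retractK (xB f)).
  rewrite -/(pB _) /tlift /tens_eval !linear_sum.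
  by apply: eq_bigr => p _; rewrite !linearZ.
rewrite (tens_repr x) linear_sum; apply: rpred_sum => p _; rewrite /= tmapE.
by apply: sub_span; exists (pA p.1), (pB p.2); rewrite !inclP.
Qed.

End TensorSeparation.

(** * The two actions of the dual algebra *)

Section Actions.
Variables (K : fieldType) (C : coalgType K).
Implicit Types (b : bool) (f g h u : dual C) (c x y : C).

(** The action f ⇀ c for [true] and c ↼ f for [false].  Statements about
[act b] and [act (~~ b)] are invariant under exchanging the two sides, so that
sources and sinks are treated by the same proofs. *)
Definition act b f c : C := if b then hitl f c else hitr c f.
Arguments act : simpl never.

Lemma act_linear b f : linear (act b f).
Proof. by case: b; [apply: hitl_linear|apply: hitr_linear]. Qed.

HB.instance Definition _ b f :=
  GRing.isLinear.Build K C C _ (act b f) (act_linear b f).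

Lemma dual_separates x y : (forall f, f x = f y) -> x = y.
Proof.
move=> xy; apply/eqP; rewrite -subr_eq0; apply: contraT => xy0.
have [f] := nonvanishing_functional xy0.
by rewrite linearB -[f x]/((f : dual C) x) xy subrr eqxx.
Qed.

(** Both sides are values of a convolution product at c. *)
Lemma act_swap b f g c : f (act b g c) = g (act (~~ b) f c).
Proof. by case: b; rewrite /act /= -?conv_hitl -?conv_hitr ?conv_hitl ?conv_hitr. Qed.

Lemma hit_comm f g c : hitl f (hitr c g) = hitr (hitl f c) g.
Proof.
pose T (x y z : C) := (g x * f z) *: y.
have T1 y z : linear (fun x => T x y z).
  by move=> k x x'; rewrite /T linearP /= mulrDl scalerDl scalerA mulrA.
have T2 x z : linear (fun y => T x y z).
  by move=> k y y'; rewrite /T scalerDr !scalerA mulrC.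
have T3 x y : linear (T x y).
  by move=> k z z'; rewrite /T linearP /= mulrDr scalerDl scalerA mulrCA.
rewrite {2}/hitl (tlift_comp _ _ (hitr_linear g)).
rewrite {1}/hitr (tlift_comp _ _ (hitl_linear f)).
transitivity (tlift (fun x y => tlift (T x) (comul y)) (comul c)).
  apply: eq_bigr => p _; rewrite linearZ /= /hitl /tlift /tens_eval scaler_sumr.
  by apply: eq_bigr => q _; rewrite /T scalerA.
rewrite -(sweedler3 T1 T2 T3); apply: eq_bigr => p _.
rewrite -[hitr _ _]/(act false g _) linearZ /act /= /hitr /tlift /tens_eval scaler_sumr.
by apply: eq_bigr => q _; rewrite /T scalerA mulrC.
Qed.

Lemma act_comm b f g c : act b f (act (~~ b) g c) = act (~~ b) g (act b f c).
Proof. by case: b; rewrite /act /= hit_comm. Qed.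

(** The product for which [act b] is a left module structure. *)
Definition mulact b f g : dual C := if b then f * g else g * f.

Lemma mulactE b f g c : mulact b f g c = f (act b g c).
Proof. by case: b; rewrite /mulact /act /= -?conv_hitl -?conv_hitr. Qed.

Lemma act_mul b f g c : act b f (act b g c) = act b (mulact b f g) c.
Proof.
by apply: dual_separates => k; rewrite act_swap -act_comm -mulactE -act_swap.
Qed.

Lemma act1 b c : act b 1 c = c.
Proof. by case: b; [apply: counitr|apply: counitl]. Qed.

Lemma act0 b c : act b 0 c = 0.
Proof. by apply: dual_separates => k; rewrite act_swap linear0. Qed.

Lemma actB b f g c : act b (f - g) c = act b f c - act b g c.
Proof.
apply: dual_separates => k; rewrite linearB [LHS]act_swap.
by rewrite [k (act b f c)]act_swap [k (act b g c)]act_swap.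
Qed.

Lemma counit_act b f c : counit (act b f c) = f c.
Proof. by rewrite -[LHS]/((counit : dual C) _) act_swap -[counit]/(1 : dual C) act1. Qed.

Lemma act_scale b k f : exists f', forall c, act b f' c = k *: act b f c.
Proof.
have lf : scalar (fun c => k * f c).
  by move=> a x y; rewrite linearP /= mulrDr mulrCA.
exists (mkdual lf) => c; apply: dual_separates => h.
by rewrite linearZ /= [LHS]act_swap [h (act b f c)]act_swap.
Qed.

(** [s] represents the comultiplication of [c] for [b] = [true], and its flip for
[b] = [false]. *)
Definition tensor_rep b c (s : seq (C * C)) :=
  forall f, act b f c = \sum_(p <- s) f p.2 *: p.1.

Lemma tensor_rep_ex b c : exists s, tensor_rep b c s.
Proof.
case: b; first by exists (repr (comul c)).
by exists [seq (p.2, p.1) | p <- repr (comul c)] => f; rewrite big_map.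
Qed.

Lemma tensor_rep_opp b c s : tensor_rep b c s ->
  forall f, act (~~ b) f c = \sum_(p <- s) f p.1 *: p.2.
Proof.
move=> sc f; apply: dual_separates => g; rewrite -act_swap sc !linear_sum.
by apply: eq_bigr => p _; rewrite !linearZ /= mulrC.
Qed.

Lemma tensor_rep_act b c s u : tensor_rep b c s ->
  tensor_rep b (act b u c) [seq (p.1, act b u p.2) | p <- s].
Proof.
move=> sc f; rewrite act_mul sc big_map.
by apply: eq_bigr => p _; rewrite mulactE.
Qed.

Definition stable b (A : {pred C}) := forall f c, c \in A -> act b f c \in A.
Definition bistable (A : {pred C}) := forall b, stable b A.

(** Contracting the comultiplication of c by a functional is acting on c, so the
subspaces stable on both sides are the subcoalgebras. *)
Lemma bistable_comul (A : submodClosed C) :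
  bistable A -> forall c, c \in A -> comul c \in tsub A A.
Proof.
move=> stA c cA; apply: tsub_intro => f; first exact: (stA true f c cA).
exact: (stA false f c cA).
Qed.

Lemma subcoalgebra_bistable (D : subcoalgebra C) : bistable D.
Proof.
move=> b f c /subcoalg_comul/asboolP[s [sD cE]]; rewrite /act /hitl /hitr cE.
case: b; rewrite tlift_sum; try exact: hitl_bilin; try exact: hitr_bilin.
  rewrite big_seq; apply: rpred_sum => p /sD[x [y [xD yD ->]]].
  rewrite tlift_tens_scale; last exact: hitl_bilin.
  by rewrite tliftE; [rewrite !rpredZ|exact: hitl_bilin].
rewrite big_seq; apply: rpred_sum => p /sD[x [y [xD yD ->]]].
rewrite tlift_tens_scale; last exact: hitr_bilin.
by rewrite tliftE; [rewrite !rpredZ|exact: hitr_bilin].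
Qed.

(** Simplicity expressed inside C, without passing to the coalgebra carried by
the subspace.  Competing subspaces A range over all of C and need only meet D:
this saves intersecting them with D. *)
Definition bisimple (D : {pred C}) :=
  (exists2 d, d \in D & d != 0) /\
  forall A : submodClosed C, bistable A ->
    (exists2 a, a \in A & a \in D /\ a != 0) -> {subset D <= A}.

End Actions.

Arguments act : simpl never.

(** * Simple subcoalgebras and the coradical *)

Section SimpleSubcoalgebras.
Variables (K : fieldType) (C : coalgType K).

Lemma incl_act (D : subcoalgebra C) b (f : dual (subv D)) (x : subv D) :
  incl (act b f x) = act b (f \o retract D : {scalar C}) (incl x).
Proof.
rewrite /act /hitl /hitr -sub_comulE.
have lin : linear (@incl _ _ D) := @incl_linear _ _ D.
case: b; rewrite (tlift_comp _ _ lin).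
  rewrite (tlift_tmap _ _ _ (hitl_bilin (f \o retract D : {scalar C}))).
  by apply: eq_bigr => p _; rewrite linearZ /= inclK.
rewrite (tlift_tmap _ _ _ (hitr_bilin (f \o retract D : {scalar C}))).
by apply: eq_bigr => p _; rewrite linearZ /= inclK.
Qed.

Lemma incl_act_restr (D : subcoalgebra C) b (f : dual C) :
  exists f' : dual (subv D), forall x, incl (act b f' x) = act b f (incl x).
Proof.
exists (f \o @incl _ _ D : {scalar subv D}) => x.
rewrite incl_act; apply: dual_separates => g.
rewrite [LHS]act_swap [RHS]act_swap /= retractK //.
exact: subcoalgebra_bistable (inclP x).
Qed.

Lemma simple_bisimple (D : subcoalgebra C) :
  simple_coalgebra (subv D) -> bisimple D.
Proof.
case=> [[x x0] simD]; split.
  exists (incl x); first exact: inclP.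
  by apply: contra x0 => /eqP x0; apply/eqP/incl_inj; rewrite x0 linear0.
move=> A stA [a aA [aD a0]].
pose A' := preimsub (@incl _ _ D) A.
have stA' : bistable A'.
  by move=> b f y yA; rewrite -[_ \in A']/(incl _ \in A) incl_act; apply: stA.
have [A0|AT] := simD (SubCoalgebra (bistable_comul stA')).
  have := A0 (retract D a); rewrite -[_ \in _]/(incl _ \in A) retractK //.
  move=> /(_ aA) ra0; case/eqP: a0; rewrite -(retractK aD) ra0; exact: linear0.
move=> d dD; have := AT (retract D d).
by rewrite -[_ \in _]/(incl _ \in A) retractK.
Qed.

Lemma bisimple_simple (D : subcoalgebra C) :
  bisimple D -> simple_coalgebra (subv D).
Proof.
case=> [[d dD d0] simD]; split.
  exists (retract D d); apply: contra d0 => /eqP rd0.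
  by rewrite -(retractK dD) rd0 linear0.
move=> A; have [[x xA x0]|/forall2NP A0] := pselect (exists2 x, x \in A & x != 0).
  right=> y; have stA : bistable (imsub (@incl _ _ D) A).
    move=> b f _ /asboolP[z zA ->]; apply/asboolP.
    have [f' f'E] := incl_act_restr D b f.
    exists (act b f' z); first exact: subcoalgebra_bistable.
    exact: (esym (f'E z)).
  have /asboolP[z zA /incl_inj->//] : incl y \in imsub (@incl _ _ D) A.
  apply: (simD _ stA); last exact: inclP.
  exists (incl x); first by apply/asboolP; exists x.
  split; first exact: inclP.
  by apply: contra x0 => /eqP x0; apply/eqP/incl_inj; rewrite x0 linear0.
by left=> y yA; have [//|/negP/negPn/eqP] := A0 y.
Qed.

Lemma bisimple_coradical (B : submodClosed C) :
  bistable B -> bisimple B -> {subset B <= coradical C}.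
Proof.
move=> stB simB c cB; apply: sub_span.
by exists (SubCoalgebra (bistable_comul stB)); split=> //; apply: bisimple_simple.
Qed.

Lemma coradical_bistable : bistable (coradical C).
Proof.
move=> b f c /asboolP[s [sD ->]]; rewrite linear_sum big_seq.
apply: rpred_sum => p /sD[D [simD pD]]; rewrite linearZ /=; apply: rpredZ.
by apply: sub_span; exists D; split=> //; apply: subcoalgebra_bistable.
Qed.

End SimpleSubcoalgebras.

(** * Spans and sums of subspaces *)

Section SpanFacts.
Variables (K : fieldType) (V : lmodType K).

Lemma in_span_closed (P : set V) : P 0 ->
  (forall a u v, P u -> P v -> P (a *: u + v)) ->
  forall v, v \in span P <-> P v.
Proof.
move=> P0 Plin v; split=> [/asboolP[s [sP ->]]|]; last exact: sub_span.
elim: s sP => [|p s IH] sP; first by rewrite big_nil.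
rewrite big_cons; apply: Plin; first by apply: sP; rewrite mem_head.
by apply: IH => q qs; apply: sP; rewrite inE qs orbT.
Qed.

Lemma in_addsub (A B : submodClosed V) v :
  v \in addsub A B <-> exists x y, [/\ x \in A, y \in B & v = x + y].
Proof.
split=> [|[x [y [xA yB ->]]]]; last first.
  by apply: rpredD; apply: sub_span; [left|right].
pose P : set V := [set v | exists x y, [/\ x \in A, y \in B & v = x + y]].
move=> vAB; apply/(in_span_closed (P := P)).
- by exists 0, 0; rewrite !rpred0 addr0.
- move=> a _ _ [x [y [xA yB ->]]] [x' [y' [xA' yB' ->]]].
  exists (a *: x + x'), (a *: y + y').
  by rewrite !rpredD ?rpredZ // scalerDr addrACA.
- apply: span_min vAB => w [wA|wB]; apply: sub_span.
    by exists w, 0; rewrite rpred0 addr0.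
  by exists 0, w; rewrite rpred0 add0r.
Qed.

End SpanFacts.

(** * Submodules, annihilators and socles *)

Section StableSubspaces.
Variables (K : fieldType) (C : coalgType K).
Implicit Types (b : bool) (f g h u : dual C) (c x y : C) (A B D Y : submodClosed C).

Definition vanishes h (A : {pred C}) := forall a, a \in A -> h a = 0.

Lemma act_vanish b h A x :
  stable (~~ b) A -> vanishes h A -> x \in A -> act b h x = 0.
Proof.
move=> stA hA xA; apply: dual_separates => k.
by rewrite act_swap hA ?linear0 //; apply: stA.
Qed.

Lemma act_counit b h A x : stable (~~ b) A ->
  (forall a, a \in A -> h a = counit a) -> x \in A -> act b h x = x.
Proof.
move=> stA hA xA; apply: dual_separates => k.
by rewrite act_swap hA ?counit_act //; apply: stA.
Qed.

(** The exchange rule [act_swap] read through functionals vanishing on A: acting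
on x by h lands in A as soon as h is zero on every element obtained by acting
on x, from the other side, with the annihilator of A. *)
Lemma act_mem b h A x : stable (~~ b) A -> 
  (forall f, vanishes f A -> h (act (~~ b) f x) = 0) -> act b h x \in A.
Proof.
move=> stA hA; apply: contraT => /separating_functional[f f0 fA].
by case/eqP: f0; rewrite -[LHS]/((f : dual C) _) act_swap; apply: hA.
Qed.

(** C is an injective comodule: the condition on annihilators gives a linear map
of submodules sending x to y, and such a map extends to the action of some
functional on the other side.  Here the extension is replaced by separating y
from A. *)
Lemma mem_annihilator b A x y : stable (~~ b) A -> x \in A ->
  (forall u, act b u x = 0 -> act b u y = 0) -> y \in A.
Proof.
move=> stA xA xy; apply: contraT => /separating_functional[u u0 uA].
case/eqP: u0; rewrite -[LHS]/((u : dual C) _) -(counit_act b) xy ?linear0 //.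
exact: act_vanish stA uA xA.
Qed.

Lemma stable_span b (P : set C) :
  (forall f x, P x -> P (act b f x)) -> stable b (span P).
Proof.
move=> stP f x /asboolP[s [sP ->]]; rewrite linear_sum big_seq.
apply: rpred_sum => p /sP pP; rewrite linearZ /=; apply: rpredZ.
by apply: sub_span; apply: stP.
Qed.

Lemma bistable_sides b (A : {pred C}) :
  stable b A -> stable (~~ b) A -> bistable A.
Proof. by case: b => stA stA' []. Qed.

Definition cyclic_submod b x : submodClosed C := span [set y | exists u, y = act b u x].

Lemma in_cyclic_submod b x y : y \in cyclic_submod b x <-> exists u, y = act b u x.
Proof.
apply: in_span_closed => [|a _ _ [u ->] [v ->]]; first by exists 0; rewrite act0.
have [u' u'E] := act_scale b (- a) u.
exists (v - u'); rewrite actB u'E scaleNr opprK addrC //.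
Qed.

Lemma mem_cyclic_submod b x : x \in cyclic_submod b x.
Proof. by apply/in_cyclic_submod; exists 1; rewrite act1. Qed.

Lemma cyclic_submod_stable b x : stable b (cyclic_submod b x).
Proof.
by apply: stable_span => f _ [u ->]; exists (mulact b f u); rewrite act_mul.
Qed.

Definition perp (I : set (dual C)) : submodClosed C :=
  span [set y | forall h, I h -> h y = 0].

Lemma in_perp (I : set (dual C)) y :
  y \in perp I <-> forall h, I h -> h y = 0.
Proof.
apply: in_span_closed => [h _|a u v uI vI h Ih]; first exact: linear0.
by rewrite linearP uI // vI // mulr0 addr0.
Qed.

(** The annihilator in C of a two-sided ideal of the dual algebra is a
subcoalgebra. *)
Lemma perp_bistable b (I : set (dual C)) :
  (forall h f, I h -> I (mulact b h f)) ->
  (forall h f, I h -> I (mulact b f h)) -> bistable (perp I).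
Proof.
move=> Ir Il; apply: (@bistable_sides b) => f y /in_perp yI; apply/in_perp => h Ih.
  by rewrite -mulactE; apply: yI; apply: Ir.
by rewrite -mulactE; apply: yI; have := Il _ f Ih; rewrite /mulact; case: (b).
Qed.

(** The submodule generated by n is simple. *)
Definition simple_generator b n :=
  n != 0 /\ forall u, act b u n != 0 -> exists u', act b u' (act b u n) = n.

Definition bispan b n : submodClosed C :=
  span [set x | exists f u, x = act (~~ b) f (act b u n)].

Lemma bispan_bistable b n : bistable (bispan b n).
Proof.
apply: (@bistable_sides b); apply: stable_span => g _ [f [u ->]].
  by exists f, (mulact b g u); rewrite act_comm act_mul.
by exists (mulact (~~ b) g f), u; rewrite act_mul.
Qed.

Lemma mem_bispan b n : n \in bispan b n.
Proof. by apply: sub_span; exists 1, 1; rewrite !act1. Qed.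

(** The subcoalgebra generated by a simple submodule N is the sum of the
translates of N under the other action, each zero or isomorphic to N.  A
nonzero element a of a competing subcoalgebra A is a sum of elements of such
translates; taken with few terms, its annihilator is contained in that of one
of the terms, so the submodule of a maps onto N and [mem_annihilator] puts a
generator of N in A. *)
Lemma simple_generator_bisimple b n :
  simple_generator b n -> bisimple (bispan b n).
Proof.
case=> n0 simn; split; first by exists n; first exact: mem_bispan.
move=> A stA [a aA [/asboolP[t [tB aE]] a0]].
suff nA : n \in A.
  by apply: span_min => _ [f [u ->]]; apply: (stA); apply: (stA).
have [s [sN {}aE]] : exists s : seq (C * dual C),
    (forall p, p \in s -> exists u, p.1 = act b u n) /\
    a = \sum_(p <- s) act (~~ b) p.2 p.1.
  rewrite {}aE {a aA a0}; elim: t tB => [|[k x] t IH] tB.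
    by exists [::]; rewrite !big_nil.
  have [|s [sN sE]] := IH; first by move=> p pt; apply: tB; rewrite inE pt orbT.
  have /= [f [u xE]] := tB _ (mem_head _ _).
  have [f' f'E] := act_scale (~~ b) k f.
  exists ((act b u n, f') :: s); split=> [p|].
    by rewrite inE => /orP[/eqP->|/sN//]; exists u.
  by rewrite !big_cons sE /= f'E xE.
have [m sm] := ubnP (size s).
elim: m => // m IH in s sm a aA a0 sN aE *.
case: s => [|p s] in sm sN aE *; first by rewrite aE big_nil eqxx in a0.
(* If u kills the first term but not a, then u a has fewer terms. *)
have [[u [up0 ua0]]|noU] := pselect (exists u, act b u p.1 = 0 /\ act b u a != 0).
  apply: (IH [seq (act b u q.1, q.2) | q <- s] _ _ (stA b u a aA) ua0).
  - by rewrite size_map.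
  - move=> _ /mapP[q qs ->] /=; have [|v ->] := sN q; first by rewrite inE qs orbT.
    by exists (mulact b u v); rewrite act_mul.
  - rewrite aE big_cons linearD /= act_comm up0 linear0 add0r linear_sum big_map.
    by apply: eq_bigr => q _; rewrite /= act_comm.
have {}noU u : act b u p.1 = 0 -> act b u a = 0.
  by move=> up0; apply/eqP; apply: contraT => ua0; case: noU; exists u.
have [u0 pE] := sN p (mem_head _ _).
have p0 : p.1 != 0.
  by apply: contra a0 => /eqP p0; rewrite -(act1 b a) noU // p0 linear0.
have pA : p.1 \in A.
  apply: (mem_annihilator (b := b) (stA _) aA) => u ua0; apply/eqP.
  apply: contraT; rewrite {1}pE act_mul => /simn[u' u'E].
  move: u'E; rewrite -act_mul -pE => u'E.
  (* w fixes p.1 and kills a, so 1 - w kills p.1 and fixes a. *)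
  pose w := mulact b u0 (mulact b u' u).
  have wp : act b w p.1 = p.1 by rewrite -!act_mul u'E -pE.
  have wa : act b w a = 0 by rewrite -!act_mul ua0 !linear0.
  case/eqP: a0; rewrite -[a](act1 b) -[LHS]subr0 -wa -actB noU //.
  by rewrite actB act1 wp subrr.
by move: p0; rewrite pE => /simn[u' <-]; apply: (stA); rewrite -pE.
Qed.

(** If the submodule of u c does not contain c, a functional h separating them
annihilates u c from the other side.  This is a linear relation between the
second tensor factors of the comultiplication of u c, and a term can be
eliminated. *)
Lemma tensor_rep_reduce b c s u h : tensor_rep b c s -> h c != 0 ->
  act (~~ b) h (act b u c) = 0 ->
  exists t, tensor_rep b (act b u c) t /\ (size t < size s)%N.
Proof.
move=> sc hc0 huc0; have ucE := tensor_rep_act u sc.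
have /hasP[p ps hp0] : has (fun p : C * C => h p.1 != 0) s.
  apply: contraT => /hasPn hs; case/eqP: hc0.
  rewrite -(act1 b c) sc linear_sum big_seq big1 // => p /hs/negPn/eqP hp.
  by rewrite linearZ /= hp mulr0.
have sp := perm_to_rem ps; set s' := rem p s in sp.
have up : h p.1 *: act b u p.2 = - \sum_(q <- s') h q.1 *: act b u q.2.
  apply/eqP; rewrite -addr_eq0 -[X in _ == X]huc0 (tensor_rep_opp ucE) big_map.
  by rewrite (perm_big _ sp) big_cons.
exists [seq (q.1 - (h q.1 / h p.1) *: p.1, act b u q.2) | q <- s']; split.
  move=> f; rewrite ucE !big_map (perm_big _ sp) big_cons /=.
  have -> : f (act b u p.2) = - \sum_(q <- s') h q.1 / h p.1 * f (act b u q.2).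
    apply: (mulfI hp0); rewrite mulrN mulr_sumr.
    have := congr1 (f : C -> K) up; rewrite linearZ linearN linear_sum /= => ->.
    congr (- _); apply: eq_bigr => q _.
    by rewrite linearZ /= mulrA mulrCA divff // mulr1.
  rewrite scaleNr scaler_suml -sumrN -big_split /=; apply: eq_bigr => q _.
  by rewrite scalerBr scalerA addrC mulrC.
by rewrite size_map (perm_size sp).
Qed.

(** Y plays the role of a proper submodule of the module W: the lemma finds in
W / Y an element of the socle, together with the simple subcoalgebra B carrying
it.  An element c of W outside Y whose comultiplication has the fewest terms
generates a simple module modulo Y, by [tensor_rep_reduce].  A functional that
vanishes on Y but not at c embeds this simple module into C. *)
Lemma socle_over b Y (W : set C) c0 :
  stable b Y -> (forall f c, W c -> W (act b f c)) -> W c0 -> c0 \notin Y ->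
  exists c B, [/\ W c, c \notin Y, bistable B, bisimple B &
                  forall h, vanishes h B -> act b h c \in Y].
Proof.
move=> stY stW Wc0 c0Y.
pose P m := `[< exists c s, [/\ W c, c \notin Y, tensor_rep b c s & size s = m] >].
have exP : exists m, P m.
  have [s sc] := tensor_rep_ex b c0.
  by exists (size s); apply/asboolP; exists c0, s.
case: (ex_minnP exP) => m /asboolP[c [s [Wc cY sc <-]]] minm {exP m}.
have back u : act b u c \notin Y -> exists u', act b u' (act b u c) = c.
  move=> ucY; have [/in_cyclic_submod[u' u'E]|] := boolP (c \in cyclic_submod b (act b u c)).
    by exists u'.
  move=> /separating_functional[h hc0 hO].
  have [|t [tc ts]] := tensor_rep_reduce (h := h) (u := u) sc hc0.
    apply: dual_separates => k; rewrite linear0 -act_swap.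
    by apply: hO; apply/in_cyclic_submod; exists k.
  suff /minm : P (size t) by rewrite leqNgt ts.
  by apply/asboolP; exists (act b u c), t; split=> //; apply: stW.
have [l lc0 lY] := separating_functional cY.
(* As l vanishes on Y, translation by l factors through the module modulo Y. *)
pose n := act (~~ b) l c.
have actn u : act b u n = act (~~ b) l (act b u c) by rewrite act_comm.
have n0 : n != 0.
  by apply: contra lc0 => /eqP n0; rewrite -[l c](counit_act (~~ b)) -/n n0 linear0.
have simn : simple_generator b n.
  split=> // u; rewrite actn => un0.
  have /back[u' u'E] : act b u c \notin Y.
    by apply: contra un0 => ucY; apply/eqP/(act_vanish _ lY ucY); rewrite negbK.
  by exists u'; rewrite act_comm u'E.
exists c, (bispan b n); split=> //; first exact: bispan_bistable.
  exact: simple_generator_bisimple.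
move=> h hB; apply: contraT => /back[u' u'E]; case/eqP: n0.
have hn : act b h n = 0.
  by apply: act_vanish hB (mem_bispan b n); apply: bispan_bistable.
by rewrite /n -u'E -act_comm -actn hn linear0.
Qed.

(** A simple subcoalgebra B distinct from D i meets it trivially, so a functional
equal to the counit on B and zero on D i fixes B and removes the summands taken
from D i. *)
Lemma bisimple_in_span (X : Type) (D : X -> submodClosed C) (P : set X) B x :
  (forall i, bistable (D i) /\ bisimple (D i)) -> bistable B -> bisimple B ->
  x \in B -> x != 0 -> x \in span [set y | exists2 i, P i & y \in D i] ->
  exists2 i, P i & D i =i B.
Proof.
move=> simD stB simB xB x0 /asboolP[s [sD xE]].
have [m sm] := ubnP (size s).
elim: m => // m IH in s sm x xB x0 sD xE *.
case: s => [|p s] in sm sD xE *; first by rewrite xE big_nil eqxx in x0.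
have [i Pi pD] := sD p (mem_head _ _); have [stD simDi] := simD i.
have [[y [yB yD y0]]|noY] := pselect (exists y, [/\ y \in B, y \in D i & y != 0]).
  exists i => // z; apply/idP/idP.
    by apply: simDi.2 => //; exists y.
  by apply: simB.2 => //; exists y.
have [y yB yD|g gB gD] := functional_glue (A := B) (B := D i) counit.
  by apply/eqP; apply: contraT => y0; case: noY; exists y.
apply: (IH [seq (q.1, act true g q.2) | q <- s] _ x xB x0).
- by rewrite size_map.
- move=> _ /mapP[q qs ->] /=; have [|j Pj qD] := sD q.
    by rewrite inE qs orbT.
  by exists j => //; exact: ((simD j).1 true g _ qD).
- rewrite -[LHS](act_counit (b := true) (stB _) gB xB) xE big_cons linearD.
  rewrite linearZ /= (act_vanish (b := true) (stD _) gD pD) scaler0 add0r linear_sum big_map.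
  by apply: eq_bigr => q _; rewrite linearZ.
Qed.

(** If z is not in Y, a functional F vanishing on Y and not at z produces the
nonzero element y = [act (~~ b) F z] of B.  It is killed by the two-sided ideal
of all h that send the submodule of z into Y.  The annihilator of this ideal is
a subcoalgebra meeting B, hence contains B, and e, which belongs to the ideal,
vanishes on B.  This stands for the fact that a nonzero element of a simple
algebra generates it as a two-sided ideal. *)
Lemma mem_of_ideal b B Y z e : bistable B -> bisimple B -> stable b Y ->
  (forall h, vanishes h B -> act b h z \in Y) -> ~ vanishes e B ->
  (forall u, act b e (act b u z) \in Y) -> z \in Y.
Proof.
move=> stB simB stY zB eB ez; apply: contraT => zY.
have [F Fz0 FY] := separating_functional zY.
pose I : set (dual C) := [set h | forall u, act b h (act b u z) \in Y].
have stI : bistable (perp I).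
  apply: (@perp_bistable b) => h f Ih u; rewrite -act_mul.
    by rewrite (act_mul b f u z); apply: Ih.
  by apply: stY; apply: Ih.
case: eB; suff BI : {subset B <= perp I} by move=> a /BI/in_perp; apply.
apply: simB.2 => //; exists (act (~~ b) F z); last split.
- apply/in_perp => h Ih; rewrite -act_swap -[LHS]/(F _) FY //.
  by have := Ih 1; rewrite act1.
- apply: act_mem => [|h hB]; rewrite ?negbK //.
  by apply: FY; apply: zB.
- by apply: contra Fz0 => /eqP y0; rewrite -[F z](counit_act (~~ b)) y0 linear0.
Qed.

End StableSubspaces.

(** * Splitting off a simple subcoalgebra *)

Section Splitting.
Variables (K : fieldType) (C : coalgType K).
Implicit Types (b : bool) (f g h u : dual C) (c x y : C) (A B D X Y : submodClosed C).

Definition disjoint_sub A B := forall x, x \in A -> x \in B -> x = 0.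

Lemma maximal_stable_complement b D : exists X : submodClosed C,
  [/\ stable b X, disjoint_sub X D &
      forall Z : submodClosed C, stable b Z -> {subset X <= Z} ->
        disjoint_sub Z D -> {subset Z <= X}].
Proof.
pose P (X : set C) :=
  [/\ forall a x y, X x -> X y -> X (a *: x + y),
      forall f x, X x -> X (act b f x) & forall x, X x -> x \in D -> x = 0].
have [F FP totF|X [[Xlin stX XD] maxX]] := @Zorn_bigcup C P.
  split=> [a u v [Y FY Yu] [Z FZ Zv]|f u [Y FY Yu]|u [Y FY Yu]]; last first.
  - by have [_ _] := FP _ FY; apply.
  - by exists Y => //; have [_ stY _] := FP _ FY; apply: stY.
  have [YZ|ZY] := totF _ _ FY FZ.
    by exists Z => //; have [Zlin _ _] := FP _ FZ; apply: Zlin => //; apply: YZ.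
  by exists Y => //; have [Ylin _ _] := FP _ FY; apply: Ylin => //; apply: ZY.
have maxP (Z : set C) : P Z -> X `<=` Z -> Z `<=` X.
  by move=> PZ XZ; apply: contrapT => nZX; apply: (maxX Z).
(* P holds of the empty set, so 0 is in X only by maximality. *)
have X0 : X 0.
  apply: (maxP (X `|` [set 0])); [split|by move=> u; left|by right].
  - move=> a u v [Xu|->] [Xv|->].
    + by left; apply: Xlin.
    + left; rewrite addr0 (_ : a *: u = (a - 1) *: u + u); first exact: Xlin.
      by rewrite scalerBl scale1r subrK.
    + by left; rewrite scaler0 add0r.
    + by right; rewrite scaler0 addr0.
  - by move=> f u [Xu|->]; [left; apply: stX|right; apply: linear0].
  - by move=> u [/XD//|->].
have XE := in_span_closed X0 Xlin.
exists (span X); split=> [f u /XE Xu|u /XE Xu uD|Z stZ XZ ZD u uZ].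
- by apply/XE; apply: stX.
- exact: XD.
apply/XE; apply: (maxP [set` Z]) uZ => [|v Xv]; last by apply/XZ/XE.
split=> [a v w vZ wZ|f v vZ|v vZ].
- by apply: rpredD => //; apply: rpredZ.
- exact: stZ.
- exact: ZD.
Qed.

(** The hypothesis on the layer says that D is its own injective hull: D has no
essential extension inside C.  Let X be a maximal stable complement of D.  If
D + X is not C, choose c outside it in the socle over D + X.  The module
endomorphism p of C that is the identity on D and zero on X sends c into the
layer over D, hence into the coradical.  After subtracting an element of D from
c, p(c) lies in the complement D' of D in the coradical, and X enlarged by c
still meets D trivially, against maximality. *)
Lemma no_second_layer_split b D D' : bistable D -> bisimple D -> stable b D' ->
  disjoint_sub D D' -> coradical C =i addsub D D' ->
  (forall c, (forall f, vanishes f (coradical C) -> act b f c \in D) ->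
     c \in coradical C) ->
  exists X : submodClosed C, [/\ stable b X, disjoint_sub X D & forall c, c \in addsub D X].
Proof.
move=> stD simD stD' DD' corE wedge.
have [X [stX XD maxX]] := maximal_stable_complement b D.
exists X; split=> // c0; apply: contraT => c0Y.
have stY : stable b (addsub D X).
  move=> f _ /in_addsub[d [x [dD xX ->]]]; apply/in_addsub; rewrite linearD.
  by exists (act b f d), (act b f x); split=> //; [apply: stD|apply: stX].
have [c [B [_ cY stB simB cB]]] :=
  @socle_over _ _ b (addsub D X) setT c0 stY (fun _ _ _ => I) I c0Y.
have [|g gD gX] := functional_glue (A := D) (B := X) counit.
  by move=> x xD /XD; apply.
have actgD d : d \in D -> act (~~ b) g d = d.
  by apply: act_counit gD; apply: stD.
have actgX x : x \in X -> act (~~ b) g x = 0.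
  by apply: act_vanish gX; rewrite negbK.
have : act (~~ b) g c \in coradical C.
  apply: wedge => f f0; rewrite act_comm.
  have /in_addsub[d [x [dD xX ->]]] : act b f c \in addsub D X.
    by apply: cB => y yB; apply: f0; apply: bisimple_coradical yB.
  by rewrite linearD /= actgD // actgX // addr0.
rewrite corE => /in_addsub[d [d' [dD d'D' gcE]]].
pose z := c - d; have gz : act (~~ b) g z = d'.
  by rewrite linearB /= gcE actgD // addrAC subrr add0r.
pose Z := addsub X (cyclic_submod b z).
have stZ : stable b Z.
  move=> f _ /in_addsub[x [w [xX wz ->]]]; apply/in_addsub; rewrite linearD.
  by exists (act b f x), (act b f w); split=> //; [apply: stX|apply: cyclic_submod_stable].
have XZ : {subset X <= Z} by move=> x xX; apply: sub_span; left.
have ZD : disjoint_sub Z D.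
  move=> _ /in_addsub[x [w [xX /in_cyclic_submod[u ->] ->]]] zD.
  apply: DD' => //; rewrite -(actgD _ zD) linearD /= actgX // add0r.
  by rewrite -act_comm gz; apply: stD'.
case/negP: cY; apply/in_addsub; exists d, z; split=> //; last by rewrite addrC subrK.
apply: (maxX Z) => //; apply: sub_span; right; exact: mem_cyclic_submod.
Qed.

(** The functions psi that are module maps from C to its dual algebra, written as
bilinear forms psi x c for which the two actions are adjoint. *)
Definition balanced b (psi : C -> dual C) :=
  forall f x c, psi (act b f x) c = psi x (act (~~ b) f c).

(** Let g be the counit on D and zero on X, so that acting by g on the side
[~~ b] projects C onto D.  The functionals h with [act b h] mapping C into D
form a two-sided ideal, and its annihilator A contains X, since acting by h
lands in D where g agrees with the counit.  The value of psi at x is in this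
ideal, because a functional vanishing on D kills x; and it is not zero on D,
because x is fixed by g, which lets one replace any argument of psi x by its
projection to D.  As D is simple, A meets it trivially. *)
Lemma balanced_split b D X psi : bistable D -> bisimple D -> stable b X ->
  disjoint_sub X D -> (forall c, c \in addsub D X) ->
  balanced b psi -> (exists2 x, x \in D & exists c, psi x c != 0) ->
  exists A, [/\ bistable A, disjoint_sub D A & forall c, c \in addsub D A].
Proof.
move=> stD simD stX XD DX bal [x xD [c0 psi0]].
have [|g gD gX] := functional_glue (A := D) (B := X) counit.
  by move=> y yD /XD; apply.
have actgX y : y \in X -> act (~~ b) g y = 0.
  by apply: act_vanish gX; rewrite negbK.
have actg c : act (~~ b) g c \in D.
  have /in_addsub[d [y [dD yX ->]]] := DX c.
  rewrite linearD /= (actgX y) // addr0 (act_counit _ gD) //; exact: stD.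
pose I : set (dual C) := [set h | forall c, act b h c \in D].
have psiI : I (psi x).
  move=> c; apply: act_mem => [|f fD]; first exact: stD.
  have fx : act b f x = 0 by apply: act_vanish fD xD; apply: stD.
  by rewrite -bal fx -(linear0 (act b 0)) bal act0 linear0.
have stI : bistable (perp I).
  apply: (@perp_bistable _ _ b) => h f Ih c; rewrite -act_mul; first exact: Ih.
  by apply: stD; apply: Ih.
exists (perp I); split=> // [y yD yI|c].
  apply/eqP; apply: contraT => y0; case/eqP: psi0.
  have xE : act b g x = x by apply: act_counit gD xD; apply: stD.
  rewrite -xE bal; apply: (in_perp I _).1 psiI; apply: simD.2 (actg c0) => //.
  by exists y.
have /in_addsub[d [y [dD yX ->]]] := DX c.
apply/in_addsub; exists d, y; split=> //; apply/in_perp => h Ih.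
rewrite -(counit_act b) -(gD _ (Ih y)) -[LHS]/((g : dual C) _) act_swap.
by rewrite actgX // linear0.
Qed.

(** A trivial complement forces D to be all of C. *)
Lemma indecomposable_simple D A :
  indecomposable C -> bistable D -> bisimple D -> bistable A ->
  disjoint_sub D A -> (forall c, c \in addsub D A) -> simple_coalgebra C.
Proof.
move=> indC stD simD stA DA all; have [[d dD d0] minD] := simD.
have A0 a : a \in A -> a = 0.
  move=> aA; apply/eqP; apply: contraT => a0; case: indC.
  exists (SubCoalgebra (bistable_comul stD)), (SubCoalgebra (bistable_comul stA)).
  split=> [||//|c]; first by exists d.
    by exists a.
  by have /in_addsub[x [y [xD yA ->]]] := all c; exists x, y.
have allD c : c \in D.
  by have /in_addsub[x [y [xD /A0-> ->]]] := all c; rewrite addr0.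
split; first by exists d.
move=> E; have [[x xE x0]|/forall2NP E0] := pselect (exists2 x, x \in E & x != 0).
  right=> c; apply: (minD E) => //; first exact: subcoalgebra_bistable.
  by exists x.
by left=> c cE; have [//|/negP/negPn/eqP] := E0 c.
Qed.

End Splitting.

(** * The bicomodule of the first coradical layer *)

Section CoradicalLayer.
Variables (K : fieldType) (C : coalgType K).
Implicit Types (b : bool) (c x y : C) (D E B Y : submodClosed C).

Let C0 := coradical C.

(** On classes modulo the coradical, the action of a functional on a summand is
that of any extension of it to C. *)
Lemma layer1_lactE (E : subcoalgebra C) (f : dual (subv E)) c :
  layer1_lact f (qproj C0 c) =
  qproj C0 (act true (f \o retract E : {scalar C}) c).
Proof.
rewrite /layer1_lact rho_rE /act /hitl (tlift_comp _ _ (@qproj_linear _ _ C0)).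
rewrite tlift_tmap; last exact: evr_bilin.
rewrite tlift_tmap; last exact: (evr_bilin _ (f \o retract E)).
by apply: eq_bigr => p _; rewrite linearZ.
Qed.

Lemma layer1_ractE (E : subcoalgebra C) (f : dual (subv E)) c :
  layer1_ract (qproj C0 c) f =
  qproj C0 (act false (f \o retract E : {scalar C}) c).
Proof.
rewrite /layer1_ract rho_lE /act /hitr (tlift_comp _ _ (@qproj_linear _ _ C0)).
rewrite tlift_tmap; last exact: evl_bilin.
rewrite tlift_tmap; last exact: (evl_bilin _ (f \o retract E)).
by apply: eq_bigr => p _; rewrite linearZ.
Qed.

(** With p a projection onto the coradical and q = 1 - p, the component of the
comultiplication in the image of q ⊗ q is zero, and the other components lie in
the two required subspaces. *)
Lemma corad_filt1_intro c :
  (forall f, vanishes f C0 -> act true f c \in C0) -> c \in corad_filt C 1.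
Proof.
move=> cC0; rewrite -[_ \in _]/(comul c \in addsub _ _).
pose p : {linear C -> C} := @incl _ _ C0 \o retract C0.
pose q : {linear C -> C} := idfun \- p.
have pq x : x = p x + q x by rewrite addrC subrK.
have qC0 x : x \in C0 -> q x = 0.
  by move=> xC0; rewrite /= retractK // subrr.
have qq0 : tmap q q (comul c) = 0.
  apply: tens_separated => f g; rewrite tlift_tmap; last exact: evr_bilin.
  have -> : tlift (fun x y => g (q y) *: q x) (comul c) =
            q (act true (g \o q : {scalar C}) c).
    rewrite /act /hitl /tlift /tens_eval linear_sum.
    by apply: eq_bigr => r _; rewrite linearZ.
  rewrite qC0; last first.
    by apply: cC0 => x xC0; rewrite -[LHS]/(g (q x)) qC0 ?linear0.
  by congr (f _); rewrite [RHS]tlift_tens0 //; apply: evr_bilin.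
have bT := tens_bilin C C.
have tensE x y : x ⊗ y = p x ⊗ y + q x ⊗ p y + q x ⊗ q y.
  by rewrite -addrA -(bilinDr bT) -pq -(bilinDl bT) -pq.
have -> : comul c = tmap p idfun (comul c) + tmap q p (comul c).
  rewrite -[RHS]addr0 -qq0 /tmap /tlift /tens_eval -!big_split.
  rewrite {1}(tens_repr (comul c)); apply: eq_bigr => r _.
  exact: tensE.
rewrite (tens_repr (comul c)) !linear_sum /=.
apply: rpredD; apply: rpred_sum => r _; rewrite tmapE; apply: sub_span.
  left; apply: sub_span; exists (p r.1), r.2.
  by split=> //; [apply: inclP|apply: in_fullsub].
right; apply: sub_span; exists (q r.1), (p r.2).
by split=> //; [apply: in_fullsub|apply: inclP].
Qed.

Lemma annihilated_act b b' B Y c u : bistable B -> bistable Y ->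
  (forall h, vanishes h B -> act b h c \in Y) ->
  forall h, vanishes h B -> act b h (act b' u c) \in Y.
Proof.
move=> stB stY cB h hB; have [<-|/negPf bb'] := eqVneq b b'.
  by rewrite act_mul cB // => y yB; rewrite mulactE hB //; apply: stB.
have -> : b' = ~~ b by move: bb'; case: (b); case: (b').
by rewrite act_comm; apply: stY; apply: cB.
Qed.

(** The class of c modulo the coradical lies in the component of left coefficients
in D and right coefficients in E: this is the form in which the two coactions
are used, and it makes the left and right conditions interchangeable. *)
Definition has_bidegree D E c :=
  (forall h, vanishes h D -> act false h c \in C0) /\
  (forall h, vanishes h E -> act true h c \in C0).

Lemma has_bidegree_act D E b u c : bistable D -> bistable E ->
  has_bidegree D E c -> has_bidegree D E (act b u c).
Proof.
move=> stD stE [cD cE]; split; apply: annihilated_act => //.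
  exact: coradical_bistable.
exact: coradical_bistable.
Qed.

Lemma layer1_comp_intro (D E : subcoalgebra C) c :
  {subset D <= C0} -> {subset E <= C0} -> has_bidegree D E c ->
  layer1_comp D E (qproj C0 c).
Proof.
move=> DC0 EC0 cDE.
have stD := @subcoalgebra_bistable _ _ D; have stE := @subcoalgebra_bistable _ _ E.
have inD f x : vanishes f C0 -> has_bidegree D E x -> act true f x \in D.
  move=> fC0 [xD _]; apply: act_mem => [|h hD]; first exact: stD.
  by apply: fC0; apply: xD.
have inE f x : vanishes f C0 -> has_bidegree D E x -> act false f x \in E.
  move=> fC0 [_ xE]; apply: act_mem => [|h hE]; first exact: stE.
  by apply: fC0; apply: xE.
have layer x : has_bidegree D E x -> qproj C0 x \in corad_layer1 C.
  move=> xDE; apply/asboolP; exists x => //; apply: corad_filt1_intro => f fC0.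
  by apply: DC0; apply: inD.
have qv (g : {scalar corad_quot C}) : vanishes (g \o qproj C0 : {scalar C}) C0.
  by move=> x /qproj0 x0; rewrite /= x0 linear0.
split; first exact: layer.
- rewrite rho_lE; apply: tsub_intro => g.
    rewrite tlift_tmap; last exact: evr_bilin.
    exact: (inD _ _ (qv g) cDE).
  rewrite tlift_tmap; last exact: evl_bilin.
  rewrite (_ : tlift _ _ = qproj C0 (act false g c)).
    exact: layer (has_bidegree_act false g stD stE cDE).
  rewrite /act /hitr (tlift_comp _ _ (@qproj_linear _ _ C0)).
  by apply: eq_bigr => p _; rewrite linearZ.
- rewrite rho_rE; apply: tsub_intro => g.
    rewrite tlift_tmap; last exact: evr_bilin.
    rewrite (_ : tlift _ _ = qproj C0 (act true g c)).
      exact: layer (has_bidegree_act true g stD stE cDE).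
    rewrite /act /hitl (tlift_comp _ _ (@qproj_linear _ _ C0)).
    by apply: eq_bigr => p _; rewrite linearZ.
  rewrite tlift_tmap; last exact: evl_bilin.
  exact: (inE _ _ (qv g) cDE).
Qed.

Lemma idempotent_nonvanishing (D : subcoalgebra C) (e : dual (subv D)) :
  e != 0 -> ~ vanishes (e \o retract D : {scalar C}) D.
Proof.
move=> /eqP e0 eD; apply: e0; apply: dualP => x.
by rewrite -{1}(inclK x); apply: (eD (incl x)); apply: inclP.
Qed.

(** The idempotents e and e' generate the simple dual algebras of D and E as
two-sided ideals, so they cannot both annihilate a nonzero bimodule; the
argument applies [mem_of_ideal] once on each side. *)
Lemma peirce_corner_nonzero (D E : subcoalgebra C) (e : dual (subv D))
    (e' : dual (subv E)) c :
  simple_coalgebra (subv D) -> simple_coalgebra (subv E) ->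
  {subset D <= C0} -> {subset E <= C0} -> e != 0 -> e' != 0 ->
  has_bidegree D E c -> c \notin C0 ->
  exists2 m, layer1_comp D E m & layer1_ract (layer1_lact e' m) e != 0.
Proof.
move=> simD simE DC0 EC0 e0 e'0 cDE cC0; apply: contrapT => /forall2NP no.
have stC0 := @coradical_bistable _ C.
have stD := @subcoalgebra_bistable _ _ D; have stE := @subcoalgebra_bistable _ _ E.
set f := (e \o retract D : {scalar C}) : dual C.
set f' := (e' \o retract E : {scalar C}) : dual C.
have ff' x : has_bidegree D E x -> act false f (act true f' x) \in C0.
  move=> xDE; have [/(_ (layer1_comp_intro DC0 EC0 xDE))//|] := no (qproj C0 x).
  by move/negP/negPn/eqP; rewrite layer1_lactE layer1_ractE => /qproj0.
case/negP: cC0.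
apply: (mem_of_ideal stD (simple_bisimple simD) (stC0 false) cDE.1
  (idempotent_nonvanishing e0)) => w.
apply: (mem_of_ideal stE (simple_bisimple simE) (stC0 true) _
  (idempotent_nonvanishing e'0)) => [|u].
  by do 2!apply: annihilated_act => //; apply: cDE.2.
rewrite -/f -/f' [act true u _](act_comm true) [act true f' _](act_comm true).
by apply: ff'; do 2!apply: has_bidegree_act => //.
Qed.

End CoradicalLayer.

(** * Sources and sinks of the Gabriel quiver *)

Section GabrielQuiver.
Variables (K : fieldType) (C : coalgType K).

(** An embedding of C into a free module over its dual algebra, read coordinate by
coordinate; [true] is the left and [false] the right version. *)
Definition cogenerated_by_dual b := forall x : C, x != 0 ->
  exists2 psi : C -> dual C, balanced b psi & exists c, psi x c != 0.

Lemma left_qcF_cogenerated : left_quasi_coFrobenius C -> cogenerated_by_dual true.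
Proof.
case=> [J [phi phi_inj]] x x0.
have /existsNP[j phij] : ~ forall j, phi x j = 0.
  move=> phi0; case/eqP: x0; apply: phi_inj; rewrite linear0.
  exact: freemodP.
exists (fun y => phi y j) => [f y c|].
  rewrite -[act true f y]/(f *: (y : lcoalg C)) linearZ.
  exact: conv_hitr.
apply: contrapT => /forallNP no; apply: phij; apply: dualP => c.
by have /negP/negPn/eqP := no c.
Qed.

Lemma right_qcF_cogenerated :
  right_quasi_coFrobenius C -> cogenerated_by_dual false.
Proof.
case=> [J [phi phi_inj]] x x0.
have /existsNP[j phij] : ~ forall j, phi x j = 0.
  move=> phi0; case/eqP: x0; apply: phi_inj; rewrite linear0.
  exact: freemodP.
exists (fun y => phi y j : dual C) => [f y c|].
  rewrite -[act false f y]/((f : (dual C)^c) *: (y : rcoalg C)) linearZ.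
  exact: conv_hitl.
apply: contrapT => /forallNP no; apply: phij; apply: dualP => c.
by have /negP/negPn/eqP := no c.
Qed.

Variables (Q : quiver) (D : vertex Q -> subcoalgebra C).
Variable e : forall i, dual (subv (D i)).
Hypothesis simD : forall i, simple_coalgebra (subv (D i)).
Hypothesis dirD : is_direct_sum (fun i => D i : submodClosed C) (coradical C).
Hypothesis e_neq0 : forall i, e i != 0.
Hypothesis arrowD : forall i j, exists b : arrow i j -> corad_quot C,
  is_basis b [set layer1_ract (layer1_lact (e i) m) (e j) |
                     m in layer1_comp (D j) (D i)].

Let bistD i : bistable (D i) := @subcoalgebra_bistable _ _ (D i).
Let bisimD i : bisimple (D i) := simple_bisimple (@simD i).

Lemma summand_sub_coradical i : {subset D i <= coradical C}.
Proof. by move=> x xD; apply: bisimple_coradical xD. Qed.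

(** Without arrows from i to j the corner spanned by them is zero, and
[peirce_corner_nonzero] applies. *)
Lemma no_arrow_bidegree i j c : (arrow i j -> False) ->
  has_bidegree (D j) (D i) c -> c \in coradical C.
Proof.
move=> no_ij cji; apply: contraT => cC0; have [a [_ aP]] := arrowD i j.
have [m mji] := peirce_corner_nonzero (simD j) (simD i)
  (@summand_sub_coradical j) (@summand_sub_coradical i) (e_neq0 j) (e_neq0 i)
  cji cC0.
have /aP/asboolP[s [sa ->]] : [set layer1_ract (layer1_lact (e i) m) (e j) |
    m in layer1_comp (D j) (D i)] (layer1_ract (layer1_lact (e i) m) (e j)).
  by exists m.
case: s sa => [|p s] sa; first by rewrite big_nil eqxx.
by have [t] := sa p (mem_head _ _); case: (no_ij t).
Qed.

Definition other_summands v : submodClosed C :=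
  span [set y | exists2 i, i <> v & y \in D i].

Lemma coradical_summandE v : coradical C =i addsub (D v) (other_summands v).
Proof.
move=> x; rewrite dirD.2; apply/idP/idP; apply: span_min => y.
  move=> [i _ yi]; have [iv|iv] := pselect (i = v).
    by apply: sub_span; left; rewrite /= -iv.
  by apply: sub_span; right; apply: sub_span; exists i.
move=> [yv|]; first by apply: sub_span; exists v.
by apply: span_min => z [i _ zi]; apply: sub_span; exists i.
Qed.

(** A common element would make D v equal to another summand D i, and then y and
-y, taken in these two summands, contradict directness of the sum. *)
Lemma summand_disjoint v : disjoint_sub (D v) (other_summands v).
Proof.
move=> y yv y'; apply/eqP; apply: contraT => y0.
have [i iv Div] := bisimple_in_span (fun i => conj (@bistD i) (bisimD i))
  (@bistD v) (bisimD v) yv y0 y'.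
pose s (t : 'I_2) := if t == ord0 then v else i.
pose w (t : 'I_2) := if t == ord0 then y else - y.
have sinj : injective s.
  have neq0 (t : 'I_2) : t != ord0 -> t = ord_max.
    by case: t => [[|[]]//] ? _; apply: val_inj.
  move=> t t'; rewrite /s.
  have [->|/neq0->] := eqVneq t ord0; have [->|/neq0->] := eqVneq t' ord0 => //.
  by move=> vi; case: iv.
have wD t : w t \in D (s t).
  by rewrite /w /s; case: ifP => // _; rewrite -scaleN1r rpredZ // Div.
have := dirD.1 2%N s w sinj wD; rewrite big_ord_recl big_ord1 /w /= subrr.
by move=> /(_ erefl ord0) /= y00; rewrite y00 eqxx in y0.
Qed.

(** An essential extension of D v in C would contain, by [socle_over], an element
outside the coradical of bidegree given by D v and some D u, hence an arrow
between u and v.  So D v splits off, on both sides by the quasi-coFrobenius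
property, and is all of C. *)
Lemma isolated_vertex_simple b (v : vertex Q) : indecomposable C -> cogenerated_by_dual b ->
  (if b then is_source v else is_sink v) -> simple_coalgebra C.
Proof.
move=> indC cog bv.
have stC0 := @coradical_bistable _ C.
have wedge c : (forall f, vanishes f (coradical C) -> act b f c \in D v) ->
    c \in coradical C.
  move=> cv; apply: contraT => cC0.
  pose W : set C :=
    [set x | forall h, vanishes h (D v) -> act (~~ b) h x \in coradical C].
  have stW f x : W x -> W (act b f x).
    by move=> Wx h hv; rewrite -act_comm; apply: stC0; apply: Wx.
  have Wc : W c.
    move=> h hv; apply: act_mem => [|f fC0]; first exact: stC0.
    by rewrite negbK hv //; apply: cv.
  have [x [B [Wx xC0 stB simB xB]]] := socle_over (stC0 b) stW Wc cC0.
  have [y yB y0] := simB.1.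
  have [|u _ BD] := bisimple_in_span (P := setT)
    (fun i => conj (@bistD i) (bisimD i)) stB simB yB y0.
    have := bisimple_coradical stB simB yB; rewrite dirD.2.
    by apply: span_min => z [i _ zi]; apply: sub_span; exists i.
  have {}xB h : vanishes h (D u) -> act b h x \in coradical C.
    by move=> hu; apply: xB => z zB; apply: hu; rewrite BD.
  rewrite /W /= in Wx.
  case/negP: xC0; case: (b) bv Wx xB => bv Wx xB.
    exact: (no_arrow_bidegree (bv u) (conj Wx xB)).
  exact: (no_arrow_bidegree (bv u) (conj xB Wx)).
have stO : stable b (other_summands v).
  by apply: stable_span => f y [i iv yi]; exists i => //; apply: bistD.
have [X [stX XD DX]] := no_second_layer_split (@bistD v) (bisimD v) stO
  (@summand_disjoint v) (@coradical_summandE v) wedge.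
have [x xv x0] := (bisimD v).1; have [psi bal psix] := cog x x0.
have [|A [stA DA all]] :=
  balanced_split (@bistD v) (bisimD v) stX XD DX bal _; first by exists x.
exact: indecomposable_simple indC (@bistD v) (bisimD v) stA DA all.
Qed.

End GabrielQuiver.

Theorem theorem6p2 (K : fieldType) (C : coalgType K)
    (hind : indecomposable C) (hnsimple : ~ simple_coalgebra C)
    (Q : quiver) (hQ : is_Gabriel_quiver C Q) :
  (left_quasi_coFrobenius C -> ~ exists v : vertex Q, is_source v) /\
  (quasi_coFrobenius C ->
     (~ exists v : vertex Q, is_source v) /\
     (~ exists v : vertex Q, is_sink v)).
Proof.
case: hQ => D [e [simD dirD prime arrowD]].
have e0 i : e i != 0 by case: (prime i).
have key b (v : vertex Q) : cogenerated_by_dual C b ->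
    ~ (if b then is_source v else is_sink v).
  by move=> cog bv; apply/hnsimple/(isolated_vertex_simple simD dirD e0 arrowD hind cog bv).
have no_source : left_quasi_coFrobenius C -> ~ exists v : vertex Q, is_source v.
  by move=> /left_qcF_cogenerated cog [v]; apply: (key true).
split=> // -[lqcF rqcF]; split; first exact: no_source.
by case=> v; apply: (key false); apply: right_qcF_cogenerated.
Qed.
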